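(* Consider $N$ agents $\dot{\tilde x}_i=\tilde A\tilde x_i+\tilde B\tilde u_i$, $y_i=\tilde C\tilde x_i$, $i=1,\dots,N$, with $\tilde x_i\in\mathbb{R}^{\kappa}$, $\tilde u_i,y_i\in\mathbb{R}^m$. Suppose that the agent system is minimum-phase and has a vector relative degree $(r_1,\dots,r_m)$; that the communication graph $\mathcal G$ with weights $a_{ij}$ is undirected and connected; and that there are constants $\omega,\vartheta>0$ such that each local cost $f_i:\mathbb{R}^m\to\mathbb{R}$, $i=1,\dots,N$, is differentiable, $\omega$-strongly convex and has $\vartheta$-Lipschitz gradient. Let $y^*$ be the minimizer of $f=\sum_{i=1}^Nf_i$, let $n=\max\{r_1,\dots,r_m\}$ and let $c_0,\dots,c_{n-1}$ be constants such that $\sum_{k=0}^{n-1}c_ks^k+s^n$ is Hurwitz. Then there is a constant $\varepsilon^*>0$ such that, for any $\varepsilon\in(0,\varepsilon^* )$, the optimal output consensus problem for these agents is solved by the control $$\begin{cases}\tilde u_i=\tilde R^{-1}(-\Upsilon\chi_i^a-S\chi_i^b+u_i),\\ v_i=-\frac{1}{\varepsilon^n}\big[c_0(y_i-z_i)+\sum_{k=1}^{n-1}\varepsilon^kc_ky_i^{(k)}\big],\\ \dot z_i=-\nabla f_i(y_i)-\sum_{j=1}^Na_{ij}(\lambda_i-\lambda_j),\\ \dot\lambda_i=\sum_{j=1}^Na_{ij}(z_i-z_j),\end{cases}\qquad i=1,\dots,N,$$ where $u_i=\mathrm{col}(u_{i1},\dots,u_{im})$ is obtained from $v_i=\mathrm{col}(v_{i1},\dots,v_{im})$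 by $u_{i\iota}^{(n-r_\iota)}=v_{i\iota}$ if $n>r_\iota$ and $u_{i\iota}=v_{i\iota}$ if $n=r_\iota$. Moreover, $y_i(t)$ converges to $y^*$ exponentially as $t\to\infty$ for $i=1,\dots,N$.
   Context: Optimal output consensus problem: given the agents, the graph and the local costs (each $f_i$ known only to agent $i$; here only the real-time gradient $\nabla f_i(y_i)$ is used), a distributed control (agent $i$ uses only its own data and information exchanged with its neighbors) solves the problem if all trajectories of the agents are bounded and $\lim_{t\to+\infty}\|y_i(t)-y^*\|=0$ for all $i$, where $y^*$ is the optimal solution of $\min_{y\in\mathbb{R}^m}f(y)$, $f(y)=\sum_{i=1}^Nf_i(y)$. Graph: nodes $1,\dots,N$, no self-loops, $a_{ii}=0$, $a_{ij}=a_{ji}\ge 0$, with $a_{ij}>0$ iff there is an edge between $i$ and $j$. Convexity: a differentiable $f_i$ is $\omega$-strongly convex if $(\nabla f_i(\zeta_1)-\nabla f_i(\zeta_2))^{\mathrm T}(\zeta_1-\zeta_2)\ge\omega\|\zeta_1-\zeta_2\|^2$ for all $\zeta_1,\zeta_2\in\mathbb{R}^m$. Vector relative degree: with $\tilde C_\iota$ the $\iota$th row of $\tilde C$ and $\tilde B_j$ the $j$th column of $\tilde B$, the system has vector relative degree $(r_1,\dots,r_m)$ if $\tilde C_\iota\tilde A^k\tilde B_j=0$ for all $1\le\iota,j\le m$, $0\le k<r_\iota-1$, and the $m\times m$ matrix $\tilde R=[\tilde C_\iota\tilde A^{r_\iota-1}\tilde B_j]_{\iota,j}$ is nonsingular.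 Normal form: put $\xi^{ib}_{\iota j}=\tilde C_\iota\tilde A^{j-1}\tilde x_i$ ($1\le j\le r_\iota$, $1\le\iota\le m$) and $\xi^{ia}_\iota=\psi_\iota\tilde x_i$ ($1\le\iota\le\kappa-\sum_jr_j$), with row vectors $\psi_\iota$ satisfying $\psi_\iota\tilde B=0$ chosen so that these together form a linear change of coordinates of $\mathbb{R}^\kappa$. Let $\chi_i^b=\mathrm{col}(\xi^{ib}_{11},\dots,\xi^{ib}_{1r_1},\dots,\xi^{ib}_{m1},\dots,\xi^{ib}_{mr_m})$ and $\chi_i^a=\mathrm{col}(\xi_1^{ia},\dots,\xi^{ia}_{\kappa-\sum_jr_j})$. In these coordinates the agent reads $\dot\chi_i^a=\Pi\chi_i^a+\Psi\chi_i^b$; $\dot\xi^{ib}_{\iota j}=\xi^{ib}_{\iota(j+1)}$ for $1\le j\le r_\iota-1$; $\dot\xi^{ib}_{\iota r_\iota}=\Upsilon_\iota\chi_i^a+S_\iota\chi_i^b+\tilde C_\iota\tilde A^{r_\iota-1}\tilde B\tilde u_i$; $y_i=\mathrm{col}(\xi_{11}^{ib},\dots,\xi_{m1}^{ib})$. This defines $\Pi,\Psi,\Upsilon_\iota,S_\iota$; $\Upsilon=\mathrm{col}(\Upsilon_1,\dots,\Upsilon_m)$, $S=\mathrm{col}(S_1,\dots,S_m)$. Minimum-phase means that the zero dynamics are stable, i.e. $\Pi$ is Hurwitz (all eigenvalues have negative real parts). Derivatives used in the control: $y_i^{(j)}=\mathrm{col}(y_{i1}^{(j)},\dots,y_{im}^{(j)})$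 with $y_{i\iota}^{(j)}=\xi^{ib}_{\iota(j+1)}$ if $j\le r_\iota-1$, $y_{i\iota}^{(j)}=u_{i\iota}$ if $j=r_\iota$, and $y_{i\iota}^{(j)}=u_{i\iota}^{(j-r_\iota)}$ if $j>r_\iota$. The quantities $u_{i\iota},\dots,u_{i\iota}^{(n-r_\iota-1)}$ (for $n>r_\iota$), $z_i,\lambda_i\in\mathbb{R}^m$ are controller states. A polynomial is Hurwitz if all its roots have negative real parts. *)

(* Defs.v *)
From HB Require Import structures.
From mathcomp Require Export all_boot all_order all_algebra.
From mathcomp Require Export complex.
From mathcomp Require Export all_classical all_reals all_analysis.
Export Order.TTheory GRing.Theory Num.Theory numFieldNormedType.Exports.

Set Implicit Arguments.
Unset Strict Implicit.
Unset Printing Implicit Defensive.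

Local Open Scope classical_set_scope.
Local Open Scope ring_scope.

(* The library norm on matrices is the max norm, so the Euclidean structure
   of R^m is introduced here. *)
Definition dotp (R : realType) (m : nat) (x y : 'cV[R]_m) : R :=
  \sum_(i < m) x i 0 * y i 0.

Definition enorm (R : realType) (m : nat) (x : 'cV[R]_m) : R :=
  Num.sqrt (dotp x x).

Definition grad (R : realType) (m : nat) (f : 'cV[R]_m -> R) (x : 'cV[R]_m) :
    'cV[R]_m :=
  \col_(j < m) 'D_(delta_mx j 0) (f : 'cV[R]_m -> R^o) x.

Definition strongly_convex (R : realType) (m : nat) (omega : R)
    (f : 'cV[R]_m -> R) : Prop :=
  forall x1 x2 : 'cV[R]_m,
    omega * enorm (x1 - x2) ^+ 2 <= dotp (grad f x1 - grad f x2) (x1 - x2).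

Definition lipschitz_grad (R : realType) (m : nat) (theta : R)
    (f : 'cV[R]_m -> R) : Prop :=
  forall x1 x2 : 'cV[R]_m,
    enorm (grad f x1 - grad f x2) <= theta * enorm (x1 - x2).

Definition minimizer (R : realType) (m : nat) (f : 'cV[R]_m -> R)
    (x0 : 'cV[R]_m) : Prop :=
  forall x : 'cV[R]_m, f x0 <= f x.

Definition hurwitz_poly (R : realType) (p : {poly R}) : Prop :=
  forall s : R[i], root (map_poly (real_complex R) p) s -> complex.Re s < 0.

Definition hurwitz_mx (R : realType) (p : nat) (M : 'M[R]_p) : Prop :=
  forall s : R[i], eigenvalue (map_mx (real_complex R) M) s -> complex.Re s < 0.

Definition weighted_graph (R : realType) (N : nat) (a : 'M[R]_N) : Prop :=
  [/\ forall i, a i i = 0, forall i j, a i j = a j i & forall i j, 0 <= a i j].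

Definition connected_graph (R : realType) (N : nat) (a : 'M[R]_N) : Prop :=
  forall i j : 'I_N, connect [rel k l | 0 < a k l] i j.

(* Channels are numbered from 0: [(C *m A ^+ k *m B) i j] is C_i A^k B_j, with
   C_i the i-th row of C and B_j the j-th column of B. *)
Definition decoupling_mx (R : realType) (kappa m : nat) (A : 'M[R]_kappa)
    (B : 'M[R]_(kappa, m)) (C : 'M[R]_(m, kappa)) (r : 'I_m -> nat) : 'M[R]_m :=
  \matrix_(i, j) (C *m A ^+ (r i).-1 *m B) i j.

Definition vector_relative_degree (R : realType) (kappa m : nat)
    (A : 'M[R]_kappa) (B : 'M[R]_(kappa, m)) (C : 'M[R]_(m, kappa))
    (r : 'I_m -> nat) : Prop :=
  [/\ forall i, (0 < r i)%N,
      forall (i j : 'I_m) (k : nat), (k < (r i).-1)%N ->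
        (C *m A ^+ k *m B) i j = 0
    & decoupling_mx A B C r \in unitmx].

(* The matrix of x |-> chi^b = col(xi^b_11, ..., xi^b_(m r_m)): its row blocks
   are indexed by the output channel i, and row j (counted from 0) of block i
   is C_i A^j. *)
Definition chib_mx (R : realType) (kappa m : nat) (A : 'M[R]_kappa)
    (C : 'M[R]_(m, kappa)) (r : 'I_m -> nat) :
    'M[R]_(\sum_(i < m) r i, kappa) :=
  \mxcol_(i < m) \matrix_(j < r i, l < kappa) (C *m A ^+ j) i l.

(* The rows psi_i complete chi^b to linear coordinates of R^kappa.  Bijectivity
   forces \sum_i r i <= kappa, so the truncated subtraction is harmless. *)
Definition coordinate_completion (R : realType) (kappa m : nat)
    (A : 'M[R]_kappa) (B : 'M[R]_(kappa, m)) (C : 'M[R]_(m, kappa))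
    (r : 'I_m -> nat) (psi : 'M[R]_(kappa - \sum_(i < m) r i, kappa)) : Prop :=
  psi *m B = 0 /\
  bijective (fun x : 'cV[R]_kappa => col_mx (psi *m x) (chib_mx A C r *m x)).

(* Pi, Psi, Ups and S are the coefficients of x' = A x + B u in the coordinates
   (chi^a, chi^b), which they determine uniquely.  The remaining equations of
   the normal form (the integrator chains and y = C x) hold by the definition
   of chi^b and of the relative degree. *)
Definition normal_form (R : realType) (kappa m : nat)
    (A : 'M[R]_kappa) (B : 'M[R]_(kappa, m)) (C : 'M[R]_(m, kappa))
    (r : 'I_m -> nat) (psi : 'M[R]_(kappa - \sum_(i < m) r i, kappa))
    (Pi : 'M[R]_(kappa - \sum_(i < m) r i))
    (Psi : 'M[R]_(kappa - \sum_(i < m) r i, \sum_(i < m) r i))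
    (Ups : 'M[R]_(m, kappa - \sum_(i < m) r i))
    (S : 'M[R]_(m, \sum_(i < m) r i)) : Prop :=
  forall (x : 'cV[R]_kappa) (u : 'cV[R]_m),
    let dx := A *m x + B *m u in
    let chia := psi *m x in
    let chib := chib_mx A C r *m x in
    psi *m dx = Pi *m chia + Psi *m chib /\
    forall i : 'I_m,
      (C *m A ^+ (r i).-1 *m dx) i 0 =
        (Ups *m chia) i 0 + (S *m chib) i 0 +
        (C *m A ^+ (r i).-1 *m B *m u) i 0.

Definition max_degree (m : nat) (r : 'I_m -> nat) : nat := \max_(i < m) r i.

(* In the control of one agent, [w i k] is the controller state u_i^(k) of
   channel i, for k < n - r_i with n = max_degree r; the entries with
   k >= n - r_i are never used. *)

(* y^(k) for k < n. *)
Definition output_deriv (R : realType) (kappa m : nat) (A : 'M[R]_kappa)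
    (C : 'M[R]_(m, kappa)) (r : 'I_m -> nat) (x : 'cV[R]_kappa)
    (w : 'I_m -> nat -> R) (k : nat) : 'cV[R]_m :=
  \col_(i < m) if (k < r i)%N then (C *m A ^+ k *m x) i 0 else w i (k - r i)%N.

Definition virtual_input (R : realType) (kappa m : nat) (A : 'M[R]_kappa)
    (C : 'M[R]_(m, kappa)) (r : 'I_m -> nat) (c : nat -> R) (eps : R)
    (x : 'cV[R]_kappa) (w : 'I_m -> nat -> R) (z : 'cV[R]_m) : 'cV[R]_m :=
  let n := max_degree r in
  - (1 / eps ^+ n) *:
    (c 0%N *: (C *m x - z) +
     \sum_(1 <= k < n) (eps ^+ k * c k) *: output_deriv A C r x w k).

(* u_i^(k) for k <= n - r_i, where u_i^(n - r_i) = v_i; in particular u_i = v_i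
   when n = r_i. *)
Definition input_deriv (R : realType) (m : nat) (r : 'I_m -> nat)
    (w : 'I_m -> nat -> R) (v : 'cV[R]_m) (i : 'I_m) (k : nat) : R :=
  if (k < max_degree r - r i)%N then w i k else v i 0.

Definition linearizing_input (R : realType) (kappa m : nat) (A : 'M[R]_kappa)
    (B : 'M[R]_(kappa, m)) (C : 'M[R]_(m, kappa)) (r : 'I_m -> nat)
    (psi : 'M[R]_(kappa - \sum_(i < m) r i, kappa))
    (Ups : 'M[R]_(m, kappa - \sum_(i < m) r i))
    (S : 'M[R]_(m, \sum_(i < m) r i)) (x : 'cV[R]_kappa) (u : 'cV[R]_m) :
    'cV[R]_m :=
  invmx (decoupling_mx A B C r) *m
    (- (Ups *m (psi *m x)) - S *m (chib_mx A C r *m x) + u).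

(* Solutions on [0, +oo): the value at 0 is attained continuously, so that no
   assumption is made on the values at negative times. *)
Definition ode_on_nneg (R : realType) (V : normedModType R) (x rhs : R -> V) :
    Prop :=
  {within [set t : R | 0 <= t], continuous x} /\
  forall t : R, 0 < t -> is_derive t (1 : R) x (rhs t).

Record trajectory (R : realType) (N kappa m : nat) := Trajectory {
  plant_state : 'I_N -> R -> 'cV[R]_kappa;
  input_state : 'I_N -> 'I_m -> nat -> R -> R;
  z_state : 'I_N -> R -> 'cV[R]_m;
  lambda_state : 'I_N -> R -> 'cV[R]_m
}.

Definition closed_loop (R : realType) (N kappa m : nat) (A : 'M[R]_kappa)
    (B : 'M[R]_(kappa, m)) (C : 'M[R]_(m, kappa)) (r : 'I_m -> nat)
    (psi : 'M[R]_(kappa - \sum_(i < m) r i, kappa))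
    (Ups : 'M[R]_(m, kappa - \sum_(i < m) r i))
    (S : 'M[R]_(m, \sum_(i < m) r i))
    (a : 'M[R]_N) (f : 'I_N -> 'cV[R]_m -> R) (c : nat -> R) (eps : R)
    (tr : trajectory R N kappa m) : Prop :=
  let x := plant_state tr in
  let z := z_state tr in
  let lam := lambda_state tr in
  let w i t := fun l k => input_state tr i l k t in
  let v i t := virtual_input A C r c eps (x i t) (w i t) (z i t) in
  let u i t := \col_(l < m) input_deriv r (w i t) (v i t) l 0 in
  forall i : 'I_N,
    [/\ ode_on_nneg (x i)
          (fun t => A *m x i t +
             B *m linearizing_input A B C psi Ups S (x i t) (u i t)),
        forall (l : 'I_m) (k : nat), (k < max_degree r - r l)%N ->
          ode_on_nneg (input_state tr i l k : R -> R^o)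
            (fun t => input_deriv r (w i t) (v i t) l k.+1),
        ode_on_nneg (z i)
          (fun t => - grad (f i) (C *m x i t) -
             \sum_(j < N) a i j *: (lam i t - lam j t))
      & ode_on_nneg (lam i)
          (fun t => \sum_(j < N) a i j *: (z i t - z j t))].

Definition bounded_on_nneg (R : realType) (p : nat) (x : R -> 'cV[R]_p) : Prop :=
  exists M : R, forall t : R, 0 <= t -> enorm (x t) <= M.

(* All states of the controlled agents, i.e. plant and controller states. *)
Definition bounded_trajectory (R : realType) (N kappa m : nat)
    (r : 'I_m -> nat) (tr : trajectory R N kappa m) : Prop :=
  forall i : 'I_N,
    [/\ bounded_on_nneg (plant_state tr i),
        forall (l : 'I_m) (k : nat), (k < max_degree r - r l)%N ->
          exists M : R, forall t : R, 0 <= t -> `|input_state tr i l k t| <= M,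
        bounded_on_nneg (z_state tr i)
      & bounded_on_nneg (lambda_state tr i)].

Definition output (R : realType) (N kappa m : nat) (C : 'M[R]_(m, kappa))
    (tr : trajectory R N kappa m) (i : 'I_N) (t : R) : 'cV[R]_m :=
  C *m plant_state tr i t.

(* [loop] is the set of trajectories of the closed-loop system under
   consideration. *)
Definition solves_optimal_output_consensus (R : realType) (N kappa m : nat)
    (C : 'M[R]_(m, kappa)) (r : 'I_m -> nat) (ystar : 'cV[R]_m)
    (loop : trajectory R N kappa m -> Prop) : Prop :=
  forall tr : trajectory R N kappa m, loop tr ->
    bounded_trajectory r tr /\
    forall i : 'I_N,
      (fun t : R => enorm (output C tr i t - ystar)) @ +oo --> (0 : R).

Definition converges_exponentially (R : realType) (p : nat) (x : R -> 'cV[R]_p)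
    (x0 : 'cV[R]_p) : Prop :=
  exists M alpha : R, 0 < alpha /\
    forall t : R, 0 <= t -> enorm (x t - x0) <= M * expR (- alpha * t).

(* Main.v *)
Require Import Defs.
From mathcomp Require Import ring lra spectral mxred.

(* Along solutions every output satisfies eps^n y^(n) + ... + eps c_1 y' + c_0 (y - z) = 0,
   so that eta_k = eps^k y^(k) - [k = 0] z obeys eps eta' = eta M - eps b z' with M
   the (Hurwitz) companion matrix: for small eps the outputs follow z, and z
   runs the primal-dual flow z' = - grad F(y) - L lambda, lambda' = L z.  With
   e = z - y_opt, mu = lambda - l_opt, where L l_opt = - grad F(y_opt) and l_opt
   has the conserved sum of lambda, the function
     |e|^2 / 2 + |mu|^2 / 2 + delta <e, L mu> + sum_kl P_kl <eta_k, eta_l>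
   decays exponentially: strong convexity controls y - y_opt = e + eta_0, the cross
   term controls L mu and hence mu (the graph is connected and mu has zero
   sum), and the Lyapunov matrix P of M controls eta with a rate 1 / eps that
   absorbs all the couplings.  The zero dynamics are a stable linear system
   driven by the bounded chains, hence bounded. *)

Set Implicit Arguments.
Unset Strict Implicit.
Unset Printing Implicit Defensive.

Local Open Scope classical_set_scope.
Local Open Scope ring_scope.

(** * Scalar differential equations on the half-line *)

Section Calculus.
Variable R : realType.
Local Notation sol x dx := (@ode_on_nneg R R^o x dx).

(** The powers of [eps] in eta_k absorb the gains of the control, so M does not involve [eps] and
    one matrix P serves every [eps]. The obstacle is twofold. The gradients are evaluated at the
    outputs and not at z: with h = grad F(y) - grad F(y_opt), strong convexity bounds <y - y_opt, h>
    from below, whereas the energy produces <e, h>. Moreover z' feeds back into the chain with a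
    weight of order one. Without the cross term nothing negative in the rate would involve mu; its
    derivative contributes - delta |L mu|^2 at the price of delta |L e|^2, which is why delta must
    be small. Hence the order of choice: delta depends on omega, theta and L only; Young's
    inequality then charges every coupling to |eta|^2, and the total charge fixes the bound on
    [eps]. The resulting decay rate is the same for all admissible [eps]. *)

Lemma ode_on_nneg_ext (x y dx dy : R -> R) :
  x =1 y -> dx =1 dy -> sol x dx -> sol y dy.
Proof. by move=> /funext -> /funext ->. Qed.

Lemma ode_on_nneg_cst (c : R) : sol (fun=> c) (fun=> 0).
Proof. by split; [apply: cst_continuous | move=> t _; apply: is_derive_cst]. Qed.

Lemma ode_on_nnegD (x y dx dy : R -> R) : sol x dx -> sol y dy ->
  sol (fun t => x t + y t) (fun t => dx t + dy t).
Proof.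
move=> [cx dx_x] [cy dy_y]; split.
  by move=> t; apply: cvgD; [exact: cx | exact: cy].
by move=> t t0; apply: is_deriveD; [exact: dx_x | exact: dy_y].
Qed.

Lemma ode_on_nnegM (x y dx dy : R -> R) : sol x dx -> sol y dy ->
  sol (fun t => x t * y t) (fun t => dx t * y t + x t * dy t).
Proof.
move=> [cx dx_x] [cy dy_y]; split.
  by move=> t; apply: cvgM; [exact: cx | exact: cy].
move=> t t0; have ? := dx_x t t0; have ? := dy_y t t0.
apply: is_derive_eq; rewrite addrC; congr (_ + _).
by rewrite /GRing.scale /= mulrC.
Qed.

Lemma ode_on_nnegZ (c : R) (x dx : R -> R) : sol x dx ->
  sol (fun t => c * x t) (fun t => c * dx t).
Proof.
move=> xdx; apply: ode_on_nneg_ext (ode_on_nnegM (ode_on_nneg_cst c) xdx) => t //=.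
by rewrite mul0r add0r.
Qed.

Lemma ode_on_nneg_sum (I : finType) (P : pred I) (x dx : I -> R -> R) :
  (forall i, P i -> sol (x i) (dx i)) ->
  sol (fun t => \sum_(i | P i) x i t) (fun t => \sum_(i | P i) dx i t).
Proof.
move=> xdx.
have H (s : seq I) : sol (fun t => \sum_(i <- s | P i) x i t)
    (fun t => \sum_(i <- s | P i) dx i t).
  elim: s => [|i s IH].
    by apply: ode_on_nneg_ext (ode_on_nneg_cst 0) => t; rewrite big_nil.
  have [Pi|NPi] := boolP (P i).
    by apply: ode_on_nneg_ext (ode_on_nnegD (xdx i Pi) IH) => t; rewrite big_cons Pi.
  by apply: ode_on_nneg_ext IH => t; rewrite big_cons (negPf NPi).
exact: H.
Qed.

Lemma ode_on_nneg_coord p (x dx : R -> 'cV[R]_p) i : ode_on_nneg x dx ->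
  sol (fun t => x t i 0) (fun t => dx t i 0).
Proof.
move=> [cx dx_x]; split.
  by move=> t; apply: cvg_comp (cx t) (@coord_continuous R p 1 i 0 (x t)).
move=> t t0; have [xt <-] := dx_x t t0.
apply: DeriveDef; first exact: ((derivable_mxP x t 1).1 xt).
by rewrite derive_mx // mxE.
Qed.

(** Integrating factor: [expR (al * s) * (x s - be / al)] has a nonpositive derivative on the open
    half-line and is continuous up to 0, hence is nonincreasing on the closed half-line. *)
Lemma gronwall (x dx : R -> R) (al be : R) : 0 < al -> sol x dx ->
  (forall t, 0 < t -> dx t <= - al * x t + be) ->
  forall t, 0 <= t -> x t <= be / al + (x 0 - be / al) * expR (- al * t).
Proof.
move=> al0 xdx hdx t t0.
pose g s : R := expR (al * s) * (x s - be / al).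
pose dg s : R := al * expR (al * s) * (x s - be / al) + expR (al * s) * dx s.
have sE : sol (fun s => expR (al * s)) (fun s => al * expR (al * s)).
  split.
    apply: continuous_subspaceT => s; apply: continuous_comp.
      exact: mulrl_continuous.
    exact: continuous_expR.
  move=> s s0.
  have H1 : is_derive s (1 : R) ( *%R al : R -> R) al.
    have H := is_deriveZ al (is_derive_id s (1 : R)).
    by apply: is_derive_eq H _; rewrite /GRing.scale /= mulr1.
  by rewrite mulrC; exact: (is_derive1_comp (is_derive_expR (al * s)) H1).
have [cg dgg] : sol g dg.
  apply: ode_on_nneg_ext (ode_on_nnegM sE (ode_on_nnegD xdx (ode_on_nneg_cst (- (be / al))))).
    by [].
  by move=> s /=; rewrite addr0.
have gle : g t <= g 0.
  apply: (@ler0_derive1_nincry _ g 0) => //.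
  - by move=> s; rewrite in_itv /= andbT => /dgg [].
  - move=> s; rewrite in_itv /= andbT => s0; have [_] := dgg s s0.
    rewrite derive1E => ->; rewrite /dg.
    have := hdx s s0; have := expR_gt0 (al * s); set E := expR _ => E0 le.
    have -> : al * E * (x s - be / al) + E * dx s =
      - (E * ((- al * x s + be) - dx s)) by field; rewrite gt_eqF.
    by rewrite oppr_le0 mulr_ge0 ?subr_ge0 // ltW.
  - by apply: continuous_subspaceW cg => s /=; rewrite in_itv /= andbT.
move: gle; rewrite /g mulr0 expR0 mul1r mulNr expRN.
have := expR_gt0 (al * t); set E := expR _ => E0 le.
rewrite -(ler_pM2l E0).
have -> : E * (be / al + (x 0 - be / al) / E) = E * (be / al) + (x 0 - be / al).
  by field; rewrite !gt_eqF.
lra.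
Qed.

Lemma gronwall_bounded (x dx : R -> R) (al be : R) : 0 < al -> sol x dx ->
  (forall t, 0 < t -> dx t <= - al * x t + be) ->
  exists B, forall t, 0 <= t -> x t <= B.
Proof.
move=> al0 xdx hdx; exists (be / al + `|x 0 - be / al|) => t t0.
apply: le_trans (gronwall al0 xdx hdx t0) _; rewrite lerD2l.
have E1 : expR (- al * t) <= 1 by rewrite -expR0 ler_expR mulNr oppr_le0 mulr_ge0 // ltW.
apply: le_trans (ler_wpM2r (expR_ge0 _) (ler_norm _)) _.
by rewrite -[leRHS]mulr1 ler_wpM2l.
Qed.

Lemma ode_on_nneg_constant (x : R -> R) : sol x (fun=> 0) ->
  forall t, 0 <= t -> x t = x 0.
Proof.
move=> [cx dx] t t0; apply/eqP; rewrite eq_le.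
have cx' : {within `[0, +oo[, continuous x}.
  by apply: continuous_subspaceW cx => s /=; rewrite in_itv /= andbT.
have d s : s \in `]0, +oo[ -> derivable x s 1 by rewrite in_itv /= andbT => /dx [].
have d0 s : s \in `]0, +oo[ -> derive1 x s = 0.
  by rewrite in_itv /= andbT derive1E => /dx [].
by rewrite (ler0_derive1_nincry d) ?(ger0_derive1_ndecry d) // => s /d0 ->.
Qed.

End Calculus.

(** * Lyapunov matrices of Hurwitz matrices *)

Section FiniteSums.
Variable R : realType.

(** Lagrange's identity: the two sides differ by half of the double sum of the squares
    [(u i * v j - u j * v i) ^+ 2]. *)
Lemma sum_cauchy_schwarz (I : finType) (u v : I -> R) :
  (\sum_i u i * v i) ^+ 2 <= (\sum_i u i ^+ 2) * (\sum_i v i ^+ 2).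
Proof.
have : 0 <= \sum_i \sum_j (u i * v j - u j * v i) ^+ 2.
  by apply: sumr_ge0 => i _; apply: sumr_ge0 => j _; apply: sqr_ge0.
have -> : \sum_i \sum_j (u i * v j - u j * v i) ^+ 2 =
    (\sum_i u i ^+ 2) * (\sum_i v i ^+ 2) + (\sum_i v i ^+ 2) * (\sum_i u i ^+ 2)
    - 2 * (\sum_i u i * v i) ^+ 2.
  rewrite expr2 !big_distrlr /= mulr_sumr -sumrN -!big_split /=.
  apply: eq_bigr => i _; rewrite mulr_sumr -sumrN -!big_split /=.
  by apply: eq_bigr => j _; ring.
by move: (\sum_i _) (\sum_i _) (\sum_i _) => a b c; lra.
Qed.

Lemma sqr_sum_le (n : nat) (u : 'I_n -> R) :
  (\sum_i u i) ^+ 2 <= n%:R * \sum_i u i ^+ 2.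
Proof.
have := sum_cauchy_schwarz u (fun=> 1).
under eq_bigr do rewrite mulr1.
by rewrite expr1n sumr_const card_ord mulrC.
Qed.

Lemma common_lower_bound (n : nat) (u : 'I_n -> R) : (forall i, 0 < u i) ->
  exists2 a, 0 < a & forall i, a <= u i.
Proof.
move=> u0; exists (\big[Order.min/1]_i u i).
  by apply: lt_bigmin => [|i _]; [exact: ltr01 | exact: u0].
by move=> i; apply: bigmin_le_cond.
Qed.

Lemma ler_sum_term (I : finType) (u : I -> R) i : (forall j, 0 <= u j) ->
  u i <= \sum_j u j.
Proof. by move=> u0; rewrite (bigD1 i) //= lerDl sumr_ge0. Qed.
End FiniteSums.

Section Lyapunov.
Variable R : realType.
Implicit Types z w t : R[i].
Local Notation Re := complex.Re.
Local Notation Im := complex.Im.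

(** The real part of [z] times the conjugate of [w], that is, the Euclidean inner product of the
    plane. Its values lie in [R], so a quadratic form built from complex coordinates has a real
    matrix. *)
Definition cip z w : R := Re z * Re w + Im z * Im w.

Lemma cip_ge0 z : 0 <= cip z z.
Proof. by rewrite /cip -!expr2 addr_ge0 ?sqr_ge0. Qed.

Lemma cip_sqr_Re z : Re z ^+ 2 <= cip z z.
Proof. by rewrite /cip -!expr2 lerDl sqr_ge0. Qed.

Lemma cip_mul z w : cip (z * w) (z * w) = cip z z * cip w w.
Proof. by case: z w => a b [c d]; rewrite /cip /=; ring. Qed.

Lemma cip_mul_same z t : cip (z * t) z = Re t * cip z z.
Proof. by case: z t => a b [c d]; rewrite /cip /=; ring. Qed.

Lemma cip_scale (a b : R) z w : cip (a%:C * z)%C (b%:C * w)%C = a * b * cip z w.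
Proof. by case: z w => c d [e f]; rewrite /cip /=; ring. Qed.

Lemma cip_young (g : R) z w : 0 < g -> cip z w <= g * cip w w + g^-1 * cip z z.
Proof.
move=> g0; suff: 0 <= g * (g * cip w w + g^-1 * cip z z - cip z w).
  by rewrite pmulr_rge0 // subr_ge0.
have -> : g * (g * cip w w + g^-1 * cip z z - cip z w) =
  g^+2 * cip w w + cip z z - g * cip z w by field; rewrite gt_eqF.
case: z w => a b [c d]; rewrite /cip /=.
have -> : g ^+ 2 * (c * c + d * d) + (a * a + b * b) - g * (a * c + b * d) =
 (g * c - 2^-1 * a) ^+ 2 + (g * d - 2^-1 * b) ^+ 2 + 3 / 4 * (a ^+ 2 + b ^+ 2) by field.
by apply: addr_ge0; [|apply: mulr_ge0; first lra]; apply: addr_ge0; apply: sqr_ge0.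
Qed.

Lemma cip_suml (I : finType) (u : I -> R[i]) w :
  cip (\sum_i u i) w = \sum_i cip (u i) w.
Proof.
elim/big_rec2: _ => [|i y z _ <-]; first by rewrite /cip /= !mul0r addr0.
by case: (u i) z => a b [c d]; rewrite /cip /=; ring.
Qed.

Lemma cip_sumr (I : finType) (u : I -> R[i]) w :
  cip w (\sum_i u i) = \sum_i cip w (u i).
Proof.
elim/big_rec2: _ => [|i y z _ <-]; first by rewrite /cip /= !mulr0 addr0.
by case: (u i) z => a b [c d]; rewrite /cip /=; ring.
Qed.

(* Triangularize M over the complex numbers, w' = w T; weighting the coordinate
   w_j by K^j with K large makes the off-diagonal part of T negligible. *)
Lemma lyapunov_triangular (n : nat) (T : 'M[R[i]]_n) (a : R) : 0 < a ->
  is_trig_mx T -> (forall j, Re (T j j) <= - a) ->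
  exists2 K : R, 1 <= K & forall w : 'I_n -> R[i],
    \sum_(j < n) K ^+ j * cip (\sum_l w l * T l j) (w j) <=
    - (a / 2) * \sum_(j < n) K ^+ j * cip (w j) (w j).
Proof.
case: n T => [|n'] T a0 /is_trig_mxP trigT diagT.
  by exists 1 => // w; rewrite !big_ord0 mulr0.
set n := n'.+1; pose tau := \sum_i \sum_j cip (T i j) (T i j).
have tau0 : 0 <= tau by do 2![apply: sumr_ge0 => ? _]; exact: cip_ge0.
have leT i j : cip (T i j) (T i j) <= tau.
  apply: le_trans (ler_sum_term i _) => [|k]; last first.
    by apply: sumr_ge0 => ? _; exact: cip_ge0.
  exact: (ler_sum_term (u := fun j => cip (T i j) (T i j)) j (fun=> cip_ge0 _)).
have n0 : 0 < n%:R :> R by rewrite ltr0n.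
(* Each weighted square is charged [g] at most [2 * n] times, [n] times as the [j] part and [n]
   times as the [l] part of a product; this consumes half of the decay [a]. *)
pose g := a / (4 * n%:R); have g0 : 0 < g by rewrite divr_gt0 ?mulr_gt0.
(* This gives [tau / g <= g * K]: for [l > j] the factor [K] gained from [K ^+ l] over [K ^+ j] pays
   for the entry [T l j]. *)
pose K := 1 + tau / (g * g); have K1 : 1 <= K.
  by rewrite lerDl divr_ge0 ?mulr_ge0 // ltW.
have K0 : 0 < K by apply: lt_le_trans K1.
have Kp j : 0 < K ^+ j by rewrite exprn_gt0.
exists K => // w.
have term (j l : 'I_n) : K ^+ j * cip (w l * T l j) (w j) <=
   (if l == j then - a * (K ^+ j * cip (w j) (w j)) else 0) +
   (g * (K ^+ j * cip (w j) (w j)) + g * (K ^+ l * cip (w l) (w l))).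
  have wj0 : 0 <= g * (K ^+ j * cip (w j) (w j)).
    by rewrite mulr_ge0 ?mulr_ge0 ?cip_ge0 // ltW.
  have wl0 : 0 <= g * (K ^+ l * cip (w l) (w l)).
    by rewrite mulr_ge0 ?mulr_ge0 ?cip_ge0 // ltW.
  case: (ltngtP l j) => [lj|jl|/val_inj ->].
  - rewrite (trigT _ _ lj) -[_ == _]/(val l == val j) (ltn_eqF lj) mulr0 add0r.
    by rewrite /cip /= !mul0r addr0 mulr0 addr_ge0.
  - rewrite -[_ == _]/(val l == val j) (gtn_eqF jl) add0r.
    apply: le_trans (ler_wpM2l (ltW (Kp j)) (cip_young _ _ g0)) _.
    rewrite mulrDr lerD //; first by rewrite mulrCA.
    rewrite cip_mul mulrCA [g * _]mulrA.
    have -> : g^-1 * (K ^+ j * (cip (w l) (w l) * cip (T l j) (T l j))) =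
      (K ^+ j * (g^-1 * cip (T l j) (T l j))) * cip (w l) (w l) by ring.
    apply: ler_wpM2r; first exact: cip_ge0.
    apply: (@le_trans _ _ (K ^+ j * (g * K))).
      rewrite ler_pM2l // mulrC ler_pdivrMr // (le_trans (leT _ _)) //.
      have -> : g * K * g = g * g + tau by rewrite /K; field; rewrite gt_eqF.
      by rewrite lerDr mulr_ge0 // ltW.
    by rewrite mulrCA ler_pM2l // -exprSr ler_weXn2l.
  - rewrite eqxx cip_mul_same -[leLHS]addr0 lerD ?addr_ge0 //.
    by rewrite mulrCA ler_wpM2r ?diagT // mulr_ge0 ?cip_ge0 // ltW.
have -> : - (a / 2) * \sum_(j < n) K ^+ j * cip (w j) (w j) =
  \sum_(j < n) \sum_(l < n) ((if l == j then - a * (K ^+ j * cip (w j) (w j)) else 0) +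
   (g * (K ^+ j * cip (w j) (w j)) + g * (K ^+ l * cip (w l) (w l)))).
  set F := \sum_(j < n) K ^+ j * cip (w j) (w j).
  under eq_bigr => j _.
    rewrite big_split -big_mkcond big_pred1_eq big_split /= sumr_const card_ord.
    rewrite -mulr_sumr -/F -[_ *+ n'.+1]mulr_natl.
    over.
  rewrite !big_split /= -!mulr_sumr -/F sumr_const card_ord -[F *+ _]mulr_natl.
  rewrite /g -/n; move: (n%:R : R) n0 => N N0.
  by field; rewrite gt_eqF.
apply: ler_sum => j _; rewrite cip_suml mulr_sumr.
by apply: ler_sum => l _; exact: term.
Qed.

(** The matrix acts on row vectors, [x' = x M]. In the complex coordinates [w = x Q] that make [M]
    triangular, [P] is, up to a factor, the Gram matrix of the weighted norm of the preceding
    lemma. *)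
Lemma lyapunov (n : nat) (M : 'M[R]_n) : hurwitz_mx M ->
  exists P : 'M[R]_n, [/\ forall i j, P i j = P j i,
    exists2 p, 0 < p & forall x : 'I_n -> R,
      p * \sum_i x i ^+ 2 <= \sum_i \sum_j P i j * (x i * x j)
    & forall x : 'I_n -> R,
      \sum_i \sum_j P i j * ((\sum_k x k * M k i) * x j) <= - \sum_i x i ^+ 2].
Proof.
case: n M => [|n'] M hM.
  exists 0; split=> [i j||x]; first by rewrite !mxE.
    by exists 1 => // x; rewrite !big_ord0 mulr0.
  by rewrite !big_ord0 oppr0.
set n := n'.+1 in M hM *.
set A := map_mx (real_complex R) M.
have [U Uu trigT] := Schur A (isT : (0 < n)%N).
have Uunit := unitarymx_unit Uu.
set T := conjmx U A in trigT; pose Q := invmx U.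
have AQ : A *m Q = Q *m T.
  by rewrite /T conjumx // -!mulmxA mulKmx.
(* The diagonal of [T] consists of eigenvalues of [M]; being finitely many, their real parts stay
   away from 0. *)
have [a a0 leT] : exists2 a, 0 < a & forall j, a <= - Re (T j j).
  apply: common_lower_bound => j; rewrite oppr_gt0; apply: hM.
  apply: (@eigenvalue_conjmx _ _ _ U A).
  - by rewrite stablemx_unit.
  - by rewrite row_free_unit.
  - rewrite [_ \in _]eigenvalue_root_char char_poly_trig // -/T.
    by rewrite (bigD1 j) //= rootM root_XsubC eqxx.
have [|K K1 hK] := lyapunov_triangular a0 trigT.
  by move=> j; rewrite lerNr leT.
pose w (x : 'I_n -> R) j := \sum_i (x i)%:C%C * Q i j.
pose P0 := \matrix_(i, k) \sum_(j < n) K ^+ j * cip (Q i j) (Q k j).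
have PE x y : \sum_i \sum_k P0 i k * (y i * x k) =
    \sum_(j < n) K ^+ j * cip (w y j) (w x j).
  transitivity (\sum_(j < n) \sum_i \sum_k K ^+ j * cip (Q i j) (Q k j) * (y i * x k)); last first.
    apply: eq_bigr => j _; apply: esym; rewrite cip_suml mulr_sumr; apply: eq_bigr => i _.
    rewrite cip_sumr mulr_sumr; apply: eq_bigr => k _; by rewrite cip_scale; ring.
  apply: esym; rewrite exchange_big; apply: eq_bigr => i _.
  rewrite exchange_big; apply: eq_bigr => k _.
  by rewrite mxE mulr_suml.
have wM x j : w (fun i => \sum_k x k * M k i) j = \sum_l w x l * T l j.
  transitivity (\sum_k (x k)%:C%C * (A *m Q) k j).
    rewrite /w; under eq_bigr do rewrite rmorph_sum mulr_suml.
    rewrite exchange_big; apply: eq_bigr => k _; rewrite mxE mulr_sumr.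
    by apply: eq_bigr => i _; rewrite mxE rmorphM /= mulrA.
  rewrite AQ; under eq_bigr do rewrite mxE mulr_sumr.
  rewrite exchange_big; apply: eq_bigr => l _; rewrite mulr_suml.
  by apply: eq_bigr => k _; rewrite mulrA.
have xE x i : x i = \sum_j Re (w x j * U j i).
  have -> : \sum_j Re (w x j * U j i) = Re (\sum_j w x j * U j i).
    elim/big_rec2: _ => [//|j y z _ ->].
    by case: (w x j * U j i) y => ? ? [? ?].
  transitivity (Re (\sum_k (x k)%:C%C * (Q *m U) k i)).
    rewrite mulVmx // (bigD1 i) //= big1 ?addr0 => [|k ki]; rewrite !mxE.
      by rewrite eqxx mulr1.
    by rewrite (negPf ki) mulr0.
  congr Re; under eq_bigr do rewrite mxE mulr_sumr.
  rewrite exchange_big; apply: eq_bigr => l _; rewrite mulr_suml.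
  by apply: eq_bigr => k _; rewrite mulrA.
pose u := \sum_j \sum_i cip (U j i) (U j i).
have u0 : 0 <= u by do 2![apply: sumr_ge0 => ? _]; exact: cip_ge0.
have leU i j : cip (U i j) (U i j) <= u.
  apply: le_trans (ler_sum_term i _) => [|k]; last first.
    by apply: sumr_ge0 => ? _; exact: cip_ge0.
  exact: (ler_sum_term (u := fun j => cip (U i j) (U i j)) j (fun=> cip_ge0 _)).
have n0 : 0 < n%:R :> R by rewrite ltr0n.
(* Recovering [x] from [w] through [U] bounds each [x i ^+ 2] by [n * (u + 1)] times the form;
   summing over [i] gives the second factor [n], and the [+ 1] keeps [d] positive. *)
pose d := n%:R * n%:R * (u + 1); pose c := d^-1.
have d0 : 0 < d by rewrite !mulr_gt0 // ltr_wpDl.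
have c0 : 0 < c by rewrite invr_gt0.
have pos x : c * \sum_i x i ^+ 2 <= \sum_i \sum_j P0 i j * (x i * x j).
  rewrite PE mulrC /c ler_pdivrMr //.
  set F := \sum_(j < n) K ^+ j * _.
  have F0 : \sum_j cip (w x j) (w x j) <= F.
    apply: ler_sum => j _; apply: ler_peMl (cip_ge0 _) _.
    exact: exprn_ege1.
  have xi i : x i ^+ 2 <= n%:R * (u + 1) * F.
    rewrite {1}xE; apply: le_trans (sqr_sum_le _) _.
    rewrite -mulrA ler_pM2l //.
    apply: (@le_trans _ _ (\sum_j (u + 1) * cip (w x j) (w x j))); last first.
      by rewrite -mulr_sumr ler_wpM2l // addr_ge0.
    apply: ler_sum => j _; apply: le_trans (cip_sqr_Re _) _.
    rewrite cip_mul mulrC ler_wpM2r ?cip_ge0 // (le_trans (leU _ _)) //.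
    by rewrite lerDl.
  apply: le_trans (ler_sum _ (fun i _ => xi i)) _.
  rewrite sumr_const card_ord -mulr_natl /d -/n le_eqVlt.
  by apply/orP; left; apply/eqP; ring.
have P0sym i j : P0 i j = P0 j i.
  by rewrite !mxE; apply: eq_bigr => k _; rewrite /cip; ring.
(* The form decays at rate [a / 2] and dominates [c] times the sum of squares, so this scaling
   normalizes the decay constant to 1. *)
pose s := 2 / (a * c).
have s0 : 0 < s by rewrite divr_gt0 ?mulr_gt0.
have scal x y : \sum_i \sum_j (s *: P0) i j * (y i * x j) =
   s * \sum_i \sum_j P0 i j * (y i * x j).
  rewrite mulr_sumr; apply: eq_bigr => i _; rewrite mulr_sumr.
  by apply: eq_bigr => j _; rewrite mxE -mulrA.
exists (s *: P0); split=> [i j||x]; first by rewrite mxE [RHS]mxE P0sym.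
  exists (s * c); first by rewrite mulr_gt0.
  by move=> x; rewrite scal -mulrA ler_pM2l ?pos.
rewrite (scal x (fun i => \sum_k x k * M k i)) PE.
under eq_bigr do rewrite wM.
apply: le_trans (ler_wpM2l (ltW s0) (hK (w x))) _.
rewrite -PE mulNr mulrN lerN2 mulrA.
have -> : s * (a / 2) = c^-1 by rewrite /s; field; rewrite !gt_eqF.
by rewrite mulrC ler_pdivlMr // mulrC.
Qed.

(** Carries the Lyapunov matrix, built for row vectors, over to the zero dynamics, which act on
    columns. *)
Lemma hurwitz_mx_tr (n : nat) (M : 'M[R]_n) : hurwitz_mx M -> hurwitz_mx M^T.
Proof.
move=> hM s; rewrite eigenvalue_root_char => sroot; apply: hM.
rewrite eigenvalue_root_char.
suff <- : char_poly (map_mx (real_complex R) M^T) = char_poly (map_mx (real_complex R) M) by [].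
rewrite /char_poly -[RHS]det_tr; congr (\det _).
by apply/matrixP => i j; rewrite !mxE eq_sym.
Qed.

End Lyapunov.

(** * The graph Laplacian *)

Section Frobenius.
Variable R : realType.

(** The agents are stacked as the rows of an N by m matrix, so that the Laplacian acts by left
    multiplication and no Kronecker product occurs; this is the Euclidean inner product of such
    stacks. *)
Definition frob (p q : nat) (X Y : 'M[R]_(p, q)) : R :=
  \sum_i \sum_j X i j * Y i j.

Section Bilinear.
Variables p q : nat.
Implicit Types X Y Z : 'M[R]_(p, q).

Lemma frobC X Y : frob X Y = frob Y X.
Proof. by do 2![apply: eq_bigr => ? _]; rewrite mulrC. Qed.

Lemma frobDl X Y Z : frob (X + Y) Z = frob X Z + frob Y Z.
Proof.
by rewrite -big_split; apply: eq_bigr => i _; rewrite -big_split; apply: eq_bigr => j _;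
   rewrite mxE mulrDl.
Qed.

Lemma frobZl c X Y : frob (c *: X) Y = c * frob X Y.
Proof.
by rewrite mulr_sumr; apply: eq_bigr => i _; rewrite mulr_sumr; apply: eq_bigr => j _;
   rewrite mxE mulrA.
Qed.

Lemma frobNl X Y : frob (- X) Y = - frob X Y.
Proof. by rewrite -scaleN1r frobZl mulN1r. Qed.

Lemma frobDr X Y Z : frob Z (X + Y) = frob Z X + frob Z Y.
Proof. by rewrite !(frobC Z) frobDl. Qed.

Lemma frobZr c X Y : frob X (c *: Y) = c * frob X Y.
Proof. by rewrite !(frobC X) frobZl. Qed.

Lemma frobNr X Y : frob X (- Y) = - frob X Y.
Proof. by rewrite !(frobC X) frobNl. Qed.

Lemma frob_suml (I : finType) (F : I -> 'M[R]_(p, q)) Y :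
  frob (\sum_i F i) Y = \sum_i frob (F i) Y.
Proof.
elim/big_rec2: _ => [|i y z _ <-]; last by rewrite frobDl.
by rewrite -(scale0r 0) frobZl mul0r.
Qed.

Lemma frob_ge0 X : 0 <= frob X X.
Proof. by do 2![apply: sumr_ge0 => ? _]; rewrite -expr2 sqr_ge0. Qed.

Lemma frob_young (g : R) X Y : 0 < g ->
  frob X Y <= g * frob X X + (4 * g)^-1 * frob Y Y.
Proof.
move=> g0.
have : 0 <= frob (2 * g *: X - Y) (2 * g *: X - Y) by apply: frob_ge0.
rewrite !(frobDl, frobDr, frobNl, frobNr, frobZl, frobZr) (frobC Y X) => le0.
rewrite -subr_ge0; suff <- : (4 * g)^-1 * (2 * g * (2 * g * frob X X - frob X Y) -
  (2 * g * frob X Y - frob Y Y)) = g * frob X X + (4 * g)^-1 * frob Y Y - frob X Y.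
  apply: mulr_ge0; first by rewrite invr_ge0 mulr_ge0 // ltW.
  by move: le0; congr (_ <= _); ring.
by field; rewrite gt_eqF.
Qed.
End Bilinear.

Lemma frob_mulmxl (p q s : nat) (A : 'M[R]_(p, q)) (X : 'M[R]_(q, s)) Y :
  frob (A *m X) Y = frob X (A^T *m Y).
Proof.
transitivity (\sum_i \sum_j \sum_k A i k * X k j * Y i j).
  by do 2![apply: eq_bigr => ? _]; rewrite mxE mulr_suml.
transitivity (\sum_k \sum_j \sum_i A i k * X k j * Y i j).
  rewrite exchange_big /= [RHS]exchange_big /=; apply: eq_bigr => j _.
  by rewrite exchange_big.
do 2![apply: eq_bigr => ? _]; rewrite mxE mulr_sumr.
by apply: eq_bigr => i _; rewrite mxE; ring.
Qed.

Lemma frob_mulmx_le (p q s : nat) (A : 'M[R]_(p, q)) (X : 'M[R]_(q, s)) :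
  frob (A *m X) (A *m X) <= frob A A * frob X X.
Proof.
have -> : frob A A * frob X X =
  \sum_i \sum_j (\sum_k A i k ^+ 2) * (\sum_k X k j ^+ 2).
  rewrite mulr_suml; apply: eq_bigr => i _; rewrite -mulr_sumr exchange_big /=.
  by congr (_ * _); do ?[apply: eq_bigr => ? _]; rewrite expr2.
do 2![apply: ler_sum => ? _]; rewrite -expr2 mxE.
exact: sum_cauchy_schwarz.
Qed.

End Frobenius.

Section Laplacian.
Variable R : realType.
Variables (N : nat) (a : 'M[R]_N).
Hypothesis (wa : weighted_graph a) (ca : connected_graph a).

Definition laplacian : 'M[R]_N := \matrix_(i, j) ((i == j)%:R * \sum_k a i k - a i j).

Lemma laplacian_sym : laplacian^T = laplacian.
Proof.
have [_ sa _] := wa; apply/matrixP => i j; rewrite !mxE sa.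
by case: eqVneq => [->|]; rewrite ?mul0r.
Qed.

Lemma laplacianE m (X : 'M[R]_(N, m)) i j :
  (laplacian *m X) i j = \sum_k a i k * (X i j - X k j).
Proof.
transitivity ((\sum_k a i k) * X i j - \sum_k a i k * X k j); last first.
  by rewrite mulr_suml -sumrB; apply: eq_bigr => k _; rewrite mulrBr.
rewrite mxE; under eq_bigr do rewrite mxE mulrBl; rewrite sumrB; congr (_ - _).
rewrite (bigD1 i) //= eqxx mul1r [X in _ + X]big1 ?addr0 // => k /negPf ki.
by rewrite eq_sym ki !mul0r.
Qed.

Local Notation ones := (const_mx 1 : 'rV[R]_N).

Lemma laplacian_ones : laplacian *m ones^T = 0.
Proof.
by apply/matrixP => i j; rewrite laplacianE !mxE big1 // => k _; rewrite !mxE subrr mulr0.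
Qed.

Lemma ones_laplacian : ones *m laplacian = 0.
Proof. by rewrite -[LHS]trmxK trmx_mul laplacian_sym laplacian_ones trmx0. Qed.

(** Exchanging the two summation indices and using the symmetry of the weights gives a second
    expression of the form; adding both completes the squares. *)
Lemma laplacian_form (v : 'cV[R]_N) :
  2 * frob v (laplacian *m v) = \sum_i \sum_k a i k * (v i 0 - v k 0) ^+ 2.
Proof.
have [_ sa _] := wa.
have E : frob v (laplacian *m v) = \sum_i \sum_k a i k * (v i 0 - v k 0) * v i 0.
  by apply: eq_bigr => i _; rewrite big_ord1 laplacianE mulrC mulr_suml.
have E' : frob v (laplacian *m v) = \sum_i \sum_k - (a i k * (v i 0 - v k 0) * v k 0).
  rewrite E exchange_big; do 2![apply: eq_bigr => ? _]; rewrite sa; ring.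
rewrite mulr_natl mulr2n {1}E E' -big_split; apply: eq_bigr => i _.
by rewrite -big_split; apply: eq_bigr => k _ /=; ring.
Qed.

(* Adding the all-ones matrix makes the Laplacian of a connected graph
   invertible and does not change it on vectors of zero sum. *)
Definition grounded_laplacian : 'M[R]_N := laplacian + const_mx 1.

Lemma grounded_laplacianE : grounded_laplacian = laplacian + ones^T *m ones.
Proof.
congr (_ + _); apply/matrixP => i j; rewrite !mxE.
by rewrite big_ord1 !mxE mulr1.
Qed.

(** Pairing a kernel vector [u] of sum [s] with its own image gives
    [frob u (laplacian *m u) + s ^+ 2 = 0]. Both terms vanish, so [u] takes equal values along
    edges, is constant by connectedness, and is 0 because its sum is 0. *)
Lemma grounded_laplacian_unit : grounded_laplacian \in unitmx.
Proof.
have [_ _ a0] := wa.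
rewrite -unitmx_tr -row_free_unit; apply: inj_row_free => v.
rewrite grounded_laplacianE linearD /= trmx_mul trmxK laplacian_sym mulmxDr => vK.
pose u := v^T; pose s := \sum_i u i 0.
have sE : v *m ones^T = s%:M.
  by apply/matrixP => i j; rewrite !ord1 !mxE mulr1n; apply: eq_bigr => k _; rewrite !mxE mulr1.
have KE : laplacian *m u + s *: ones^T = 0.
  rewrite -[LHS]trmxK linearD /= trmx_mul laplacian_sym trmxK linearZ /= trmxK.
  by rewrite -mul_scalar_mx -sE -mulmxA vK trmx0.
have frob_ones : frob u ones^T = s.
  by apply: eq_bigr => i _; rewrite big_ord1 !mxE mulr1.
have /eqP : 2 * frob u (laplacian *m u) + 2 * s ^+ 2 = 0.
  by rewrite expr2 -{2}frob_ones -mulrDr -frobZr -frobDr KE -(scale0r 0) frobZr mul0r mulr0.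
rewrite laplacian_form paddr_eq0; last 2 first.
- by do 2![apply: sumr_ge0 => ? _]; rewrite mulr_ge0 ?sqr_ge0.
- by apply: mulr_ge0 => //; exact: sqr_ge0.
rewrite mulf_eq0 pnatr_eq0 /= sqrf_eq0 => /andP[/eqP E0 /eqP s0].
have edge i k : 0 < a i k -> u i 0 = u k 0.
  move=> aik; have := E0; move/eqP; rewrite psumr_eq0 => [/allP/(_ i)|j _]; last first.
    by apply: sumr_ge0 => ? _; rewrite mulr_ge0 ?sqr_ge0.
  rewrite mem_index_enum => /(_ isT)/implyP/(_ isT).
  rewrite psumr_eq0 => [/allP/(_ k)|j _]; last by rewrite mulr_ge0 ?sqr_ge0.
  rewrite mem_index_enum => /(_ isT)/implyP/(_ isT).
  by rewrite mulf_eq0 gt_eqF //= sqrf_eq0 subr_eq0 => /eqP.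
have cst i k : u i 0 = u k 0.
  have /connectP[p] := ca i k.
  elim: p i => [|j p IH] i /=; first by move=> _ ->.
  by case/andP => /edge -> pth lst; apply: IH.
apply/rowP => i; have ui : u i 0 = v 0 i by rewrite mxE.
rewrite -ui [RHS]mxE; move: s0; rewrite /s.
under eq_bigr do rewrite (cst _ i).
rewrite sumr_const card_ord => /eqP; rewrite mulrn_eq0 => /orP[/eqP N0|/eqP //].
by have := ltn_ord i; rewrite [X in (_ < X)%N]N0 ltn0.
Qed.

(** On columns of zero sum the grounded Laplacian and the Laplacian agree, so [X] is the inverse of
    the former applied to [laplacian *m X]; its Frobenius norm replaces the spectral gap. *)
Lemma laplacian_coercive m : exists2 s : R, 0 < s & forall X : 'M[R]_(N, m),
  ones *m X = 0 -> frob X X <= s * frob (laplacian *m X) (laplacian *m X).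
Proof.
pose K := grounded_laplacian; exists (frob (invmx K) (invmx K) + 1).
  by rewrite ltr_wpDl ?frob_ge0.
move=> X X0; rewrite -{1 2}(mulKmx grounded_laplacian_unit X).
apply: le_trans (frob_mulmx_le _ _) _.
have -> : grounded_laplacian *m X = laplacian *m X.
  by rewrite grounded_laplacianE mulmxDl -mulmxA X0 mulmx0 addr0.
by apply: ler_wpM2r; rewrite ?frob_ge0 // lerDl.
Qed.

(** Supplies the multiplier equilibrium with prescribed column sums. For the solution of
    [K *m X = ones^T *m s - G], multiplying by [ones] on the left gives [ones *m X = s], after which
    the rank-one part of [K] cancels the term with [s]. *)
Lemma laplacian_solve m (G : 'M[R]_(N, m)) (s : 'rV[R]_m) : (0 < N)%N ->
  ones *m G = 0 -> exists2 X, ones *m X = s & laplacian *m X = - G.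
Proof.
move=> N0 G0; pose K := grounded_laplacian.
have NN0 : N%:R != 0 :> R by rewrite pnatr_eq0 -lt0n.
have onesK : ones *m K = N%:R *: ones.
  rewrite /K grounded_laplacianE mulmxDr ones_laplacian add0r mulmxA.
  rewrite -mul_scalar_mx; congr (_ *m _); apply/matrixP => i j; rewrite !ord1 !mxE mulr1n.
  by under eq_bigr do rewrite !mxE mulr1; rewrite sumr_const card_ord.
pose X := invmx K *m (ones^T *m s - G).
have KX : K *m X = ones^T *m s - G by rewrite mulKVmx // grounded_laplacian_unit.
have onesX : ones *m X = s.
  apply: (scalerI NN0); rewrite scalemxAl -onesK -mulmxA KX mulmxBr G0 subr0 mulmxA.
  rewrite -mul_scalar_mx; congr (_ *m _); apply/matrixP => i j; rewrite !ord1 !mxE mulr1n.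
  by under eq_bigr do rewrite !mxE mulr1; rewrite sumr_const card_ord.
exists X => //; move: KX; rewrite /K grounded_laplacianE mulmxDl -mulmxA onesX.
by rewrite addrC => /addrI.
Qed.

End Laplacian.

(** * Decay of the slow-fast system *)

Section MatrixOde.
Variable R : realType.

Definition mx_ode_on_nneg (p q : nat) (X dX : R -> 'M[R]_(p, q)) : Prop :=
  forall i j, @ode_on_nneg R R^o (fun t => X t i j) (fun t => dX t i j).

Lemma mx_ode_mulmx (p q s : nat) (A : 'M[R]_(p, q)) (X dX : R -> 'M[R]_(q, s)) :
  mx_ode_on_nneg X dX -> mx_ode_on_nneg (fun t => A *m X t) (fun t => A *m dX t).
Proof.
move=> hX i j.
apply: (@ode_on_nneg_ext _ (fun t => \sum_k A i k * X t k j) _ (fun t => \sum_k A i k * dX t k j)).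
- by move=> t; rewrite mxE.
- by move=> t; rewrite mxE.
- by apply: ode_on_nneg_sum => k _; apply: ode_on_nnegZ; apply: hX.
Qed.

Lemma ode_frob (p q : nat) (X dX Y dY : R -> 'M[R]_(p, q)) :
  mx_ode_on_nneg X dX -> mx_ode_on_nneg Y dY ->
  @ode_on_nneg R R^o (fun t => frob (X t) (Y t))
    (fun t => frob (dX t) (Y t) + frob (X t) (dY t)).
Proof.
move=> hX hY.
apply: (@ode_on_nneg_ext _ (fun t => \sum_i \sum_j X t i j * Y t i j) _
  (fun t => \sum_i \sum_j (dX t i j * Y t i j + X t i j * dY t i j))) => // [t|].
  rewrite -big_split; apply: eq_bigr => i _; exact: big_split.
by do 2![apply: ode_on_nneg_sum => ? _]; apply: ode_on_nnegM; [apply: hX|apply: hY].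
Qed.

End MatrixOde.

Section SlowFast.
Variables (R : realType) (N m n : nat).
Implicit Types (P M : 'M[R]_n) (eta : 'I_n -> 'M[R]_(N, m)) (b : 'I_n -> R).

Definition gram_form P (X Y : 'I_n -> 'M[R]_(N, m)) : R :=
  \sum_k \sum_l P k l * frob (X k) (Y l).

(** For fixed [i] and [j] this is the scalar form of [P] on the vectors of the entries [(i, j)];
    inequalities for scalar forms can therefore be summed over the entries. *)
Lemma gram_formE P X Y : gram_form P X Y =
  \sum_i \sum_j \sum_k \sum_l P k l * (X k i j * Y l i j).
Proof.
transitivity (\sum_k \sum_l \sum_i \sum_j P k l * (X k i j * Y l i j)).
  do 2![apply: eq_bigr => ? _]; rewrite mulr_sumr; apply: eq_bigr => i _.
  by rewrite mulr_sumr.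
under eq_bigr do rewrite exchange_big.
rewrite exchange_big; apply: eq_bigr => i _ /=.
under eq_bigr do rewrite exchange_big.
by rewrite exchange_big.
Qed.

Lemma gram_formDl P X Y Z :
  gram_form P (fun k => X k + Y k) Z = gram_form P X Z + gram_form P Y Z.
Proof.
rewrite /gram_form -big_split; apply: eq_bigr => k _; rewrite -big_split.
by apply: eq_bigr => l _; rewrite /= frobDl mulrDr.
Qed.

Lemma gram_formZl P c X Y : gram_form P (fun k => c *: X k) Y = c * gram_form P X Y.
Proof.
rewrite /gram_form mulr_sumr; apply: eq_bigr => k _; rewrite mulr_sumr.
by apply: eq_bigr => l _; rewrite frobZl mulrCA.
Qed.

Lemma gram_formC P X Y : (forall k l, P k l = P l k) ->
  gram_form P X Y = gram_form P Y X.
Proof.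
move=> symP; rewrite /gram_form exchange_big; do 2![apply: eq_bigr => ? _].
by rewrite symP frobC.
Qed.

Lemma sum_frobE (X : 'I_n -> 'M[R]_(N, m)) :
  \sum_k frob (X k) (X k) = \sum_i \sum_j \sum_k X k i j ^+ 2.
Proof.
rewrite exchange_big; apply: eq_bigr => i _; rewrite exchange_big.
by do 2![apply: eq_bigr => ? _]; rewrite expr2.
Qed.

Lemma frob_lincomb_le (c : 'I_n -> R) (X : 'I_n -> 'M[R]_(N, m)) :
  frob (\sum_k c k *: X k) (\sum_k c k *: X k) <=
  (\sum_k c k ^+ 2) * \sum_k frob (X k) (X k).
Proof.
rewrite sum_frobE mulr_sumr; apply: ler_sum => i _; rewrite mulr_sumr.
apply: ler_sum => j _; rewrite -expr2 summxE.
under eq_bigr do rewrite mxE.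
exact: sum_cauchy_schwarz.
Qed.

Lemma gram_lyapunov M : hurwitz_mx M -> exists P, [/\ forall k l, P k l = P l k,
    exists2 p, 0 < p & forall X,
      p * \sum_k frob (X k) (X k) <= gram_form P X X
    & forall X, gram_form P (fun k => \sum_j M j k *: X j) X <=
      - \sum_k frob (X k) (X k)].
Proof.
move=> /lyapunov[P [symP [p p0 posP] negP]]; exists P; split=> // [|X].
  exists p => // X; rewrite gram_formE sum_frobE mulr_sumr; apply: ler_sum => i _.
  by rewrite mulr_sumr; apply: ler_sum => j _.
rewrite gram_formE sum_frobE -sumrN; apply: ler_sum => i _; rewrite -sumrN.
apply: ler_sum => j _; apply: le_trans (negP (fun k => X k i j)).
rewrite le_eqVlt; apply/orP; left; apply/eqP; do 2![apply: eq_bigr => ? _].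
rewrite summxE; congr (_ * (_ * _)); apply: eq_bigr => k _.
by rewrite mxE mulrC.
Qed.

Lemma gram_form_le P : exists2 p, 0 <= p & forall X,
  gram_form P X X <= p * \sum_k frob (X k) (X k).
Proof.
exists (\sum_k \sum_l `|P k l|) => [|X]; first by do 2![apply: sumr_ge0 => ? _].
rewrite mulr_suml; apply: ler_sum => k _; rewrite mulr_suml; apply: ler_sum => l _.
apply: le_trans (ler_norm _) _; rewrite normrM ler_wpM2l //.
set H := \sum_k _.
have leH i : frob (X i) (X i) <= H.
  exact: (ler_sum_term (u := fun i => frob (X i) (X i)) i (fun=> frob_ge0 _)).
(* With this weight both coefficients of Young's inequality equal 1/2, so every [frob (X k) (X l)]
   is at most [H] in absolute value. *)
have h : 0 < (2^-1 : R) by [].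
have := frob_young (X k) (X l) h; have := frob_young (- X k) (X l) h.
rewrite !frobNl frobNr opprK ler_norml.
have := leH k; have := leH l.
have -> : (4 * 2^-1 : R)^-1 = 2^-1 by field.
by move=> ? ? ? ?; apply/andP; split; lra.
Qed.

End SlowFast.

(** * Dissipation of the storage function *)

Section Estimate.
Variables (R : realType) (N m n : nat).
Variables (L : 'M[R]_N) (M P : 'M[R]_n) (b : 'I_n -> R).

Definition storage (delta : R) (e mu : 'M[R]_(N, m)) (eta : 'I_n -> 'M[R]_(N, m)) : R :=
  2^-1 * frob e e + 2^-1 * frob mu mu + delta * frob e (L *m mu) +
  gram_form P eta eta.

Definition fast_rhs (eps : R) (w : 'M[R]_(N, m)) (eta : 'I_n -> 'M[R]_(N, m)) (k : 'I_n) :=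
  eps^-1 *: (\sum_j M j k *: eta j) + b k *: w.

(* The derivative of [storage] along e' = - w, mu' = L e, eta' = fast_rhs. *)
Definition storage_rate (eps delta : R) (w e mu : 'M[R]_(N, m))
    (eta : 'I_n -> 'M[R]_(N, m)) : R :=
  frob (- w) e + frob (L *m e) mu +
  delta * (frob (- w) (L *m mu) + frob e (L *m (L *m e))) +
  2 * gram_form P (fast_rhs eps w eta) eta.

(** Here [q] stands for y - y_opt and [h] for the deviation of the gradients. The rate contains
    [- omega * frob q q], [- delta * frob nu nu] with [nu = L *m mu], and the fast decay of order
    [eps^-1]; half of each of the first two is spent on couplings, and the third takes all the
    rest. *)
Lemma storage_decay (omega theta2 ell s p : R) :
  L^T = L -> 0 < omega -> 0 < theta2 -> 0 <= ell -> 0 < s -> 0 < p ->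
  (forall X : 'M[R]_(N, m), frob (L *m X) (L *m X) <= ell * frob X X) ->
  (forall X : 'I_n -> 'M[R]_(N, m),
    p * \sum_k frob (X k) (X k) <= gram_form P X X) ->
  (forall X : 'I_n -> 'M[R]_(N, m),
    gram_form P (fun k => \sum_j M j k *: X j) X <= - \sum_k frob (X k) (X k)) ->
  exists delta eps_star rho c : R,
  [/\ 0 < eps_star, 0 < rho, 0 < c &
   forall (eps : R) (h e mu : 'M[R]_(N, m)) (eta : 'I_n -> 'M[R]_(N, m)),
    0 < eps -> eps < eps_star ->
    frob mu mu <= s * frob (L *m mu) (L *m mu) ->
    let q := e + \sum_k b k *: eta k in
    omega * frob q q <= frob q h ->
    frob h h <= theta2 * frob q q ->
    c * (frob e e + frob mu mu + \sum_k frob (eta k) (eta k)) <= storage delta e mu eta /\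
    storage_rate eps delta (h + L *m mu) e mu eta <= - rho * storage delta e mu eta].
Proof.
move=> symL omega0 th2 ell0 s0 p0 leL posP negP.
have [p3 p30 leP] := gram_form_le N m P.
pose b2 := \sum_k b k ^+ 2.
have b20 : 0 <= b2 by apply: sumr_ge0 => k _; apply: sqr_ge0.
pose c_ l := \sum_k P k l * b k.
pose p2 := \sum_l c_ l ^+ 2.
have p20 : 0 <= p2 by apply: sumr_ge0 => k _; apply: sqr_ge0.
(* One choice for three demands on [delta = omega / D]: the terms that the cross term adds in [q]
   cost at most [omega / 4], while [delta] and [delta * ell] stay below 1/4, which keeps the storage
   function positive definite. *)
pose D := 4 * (theta2 + 2 * ell + omega + omega * ell).
have oell : 0 <= omega * ell by rewrite mulr_ge0 // ltW.
have D0 : 0 < D by rewrite /D; lra.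
pose delta := omega / D.
have delta0 : 0 < delta by rewrite divr_gt0.
have deltaD : delta * D = omega by rewrite /delta; field; rewrite gt_eqF.
have delta1 : delta * (theta2 + 2 * ell) <= omega / 4.
  rewrite ler_pdivlMr // -deltaD -mulrA ler_pM2l // /D; lra.
have delta2 : delta <= 4^-1.
  rewrite /delta ler_pdivrMr // /D; lra.
have delta3 : delta * ell <= 4^-1.
  rewrite /delta mulrAC ler_pdivrMr // /D; lra.
(* The multiples of [H] left by Young's inequality: [k1] from [frob eta0 h], [k2] and [k3] from the
   input of the chain paired with [h] and [nu], and the last summand of [k'] from
   [delta * frob (L *m e) (L *m e)]. The bound on [eps] is the inverse of [k']. *)
pose k1 := b2 * theta2 * 2 / omega.
pose k2 := 8 * p2 * theta2 / omega.
pose k3 := 4 * p2 / delta.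
pose k' := k1 + k2 + k3 + 2 * delta * ell * b2 + 1.
have th2' := ltW th2; have omega0' := ltW omega0; have delta0' := ltW delta0.
have k10 : 0 <= k1 by rewrite /k1; do ?[apply: divr_ge0 => // | apply: mulr_ge0 => //].
have k20 : 0 <= k2 by rewrite /k2; do ?[apply: divr_ge0 => // | apply: mulr_ge0 => //].
have k30 : 0 <= k3 by rewrite /k3; do ?[apply: divr_ge0 => // | apply: mulr_ge0 => //].
have k40 : 0 <= 2 * delta * ell * b2 by do ?[apply: mulr_ge0 => //].
have k'0 : 0 < k' by rewrite /k'; lra.
(* Bounds the storage function by the dissipated quantities [q], [nu] and [H]; [s] enters because
   [mu] is seen only through [nu]. *)
pose c2 := (2^-1 + delta) * 2 + 2^-1 * s + delta + p3 + (2^-1 + delta) * (2 * b2).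
have c20 : 0 < c2.
  have : 0 <= (2^-1 + delta) * (2 * b2) by do ?[apply: mulr_ge0 => //]; apply: addr_ge0.
  by rewrite /c2; lra.
pose r := Num.min (omega / 2) (Num.min (delta / 2) 1).
have r0 : 0 < r by rewrite /r !lt_min ltr01 andbT; apply/andP; split; apply: divr_gt0.
have [r1 [r2 r3]] : r <= omega / 2 /\ r <= delta / 2 /\ r <= 1.
  by rewrite /r !ge_min !lexx ?orbT.
exists delta, k'^-1, (r / c2), (Num.min 4^-1 p); split.
- by rewrite invr_gt0.
- by rewrite divr_gt0.
- by rewrite lt_min p0 invr_gt0 ltr0n.
move=> eps h e mu eta eps0 epsk muL q qh hh.
pose eta0 := \sum_k b k *: eta k; pose nu := L *m mu.
set H := \sum_k frob (eta k) (eta k).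
pose g := \sum_l c_ l *: eta l.
have H0 : 0 <= H by apply: sumr_ge0 => k _; apply: frob_ge0.
have O_le : frob eta0 eta0 <= b2 * H by apply: frob_lincomb_le.
have g_le : frob g g <= p2 * H by apply: frob_lincomb_le.
have A0 := frob_ge0 q; have V0 := frob_ge0 nu; have E0 := frob_ge0 e; have U0 := frob_ge0 mu.
have eE : e = q - eta0 by rewrite /q addrK.
clearbody q; clearbody eta0.
have E_le : frob e e <= 2 * frob q q + 2 * (b2 * H).
  have := frob_ge0 (q + eta0); rewrite eE.
  rewrite !(frobDl, frobDr, frobNl, frobNr) (frobC eta0 q); lra.
have V_le : frob nu nu <= ell * frob mu mu by apply: leL.
have formb w : gram_form P (fun k => b k *: w) eta = frob w g.
  rewrite frobC frob_suml /gram_form exchange_big; apply: eq_bigr => l _.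
  by rewrite frobZl mulr_suml; apply: eq_bigr => k _; rewrite frobZl frobC; ring.
have env : frob e nu <= frob e e + 4^-1 * frob nu nu.
  by have := frob_young e nu ltr01; rewrite mulr1 mul1r.
have env' : - frob e nu <= frob e e + 4^-1 * frob nu nu.
  by have := frob_young (- e) nu ltr01; rewrite mulr1 mul1r !frobNl frobNr opprK.
have posH : p * H <= gram_form P eta eta by apply: posP.
have leH : gram_form P eta eta <= p3 * H by apply: leP.
have d_env : delta * frob e nu <= delta * (frob e e + 4^-1 * frob nu nu).
  by rewrite ler_pM2l.
have d_env' : - (delta * frob e nu) <= delta * (frob e e + 4^-1 * frob nu nu).
  by rewrite -mulrN ler_pM2l.
have dE1 : delta * frob e e <= 4^-1 * frob e e by rewrite ler_wpM2r.
have dV : delta * frob nu nu <= 4^-1 * frob mu mu.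
  apply: (@le_trans _ _ (delta * (ell * frob mu mu))); first by rewrite ler_pM2l.
  by rewrite mulrA ler_wpM2r.
split.
  set c := Num.min _ _.
  have cE : c * frob e e <= 4^-1 * frob e e by rewrite ler_wpM2r // ge_min lexx.
  have cU : c * frob mu mu <= 4^-1 * frob mu mu by rewrite ler_wpM2r // ge_min lexx.
  have cH : c * H <= p * H by rewrite ler_wpM2r // ge_min lexx orbT.
  rewrite /storage -/nu !mulrDr in d_env' *; lra.
have storage_le : storage delta e mu eta <= c2 * (frob q q + frob nu nu + H).
  have dE : delta * frob e e <= delta * (2 * frob q q + 2 * (b2 * H)) by rewrite ler_pM2l.
  have sV : 0 <= s * frob nu nu by rewrite mulr_ge0 // ltW.
  have t1 : 0 <= delta * frob q q by rewrite mulr_ge0 // ltW.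
  have t2 : 0 <= s * H by rewrite mulr_ge0 // ltW.
  have t3 : 0 <= s * frob q q by rewrite mulr_ge0 // ltW.
  have t4 : 0 <= p3 * frob q q by rewrite mulr_ge0.
  have t5 : 0 <= p3 * frob nu nu by rewrite mulr_ge0.
  have t6 : 0 <= delta * frob nu nu by rewrite mulr_ge0 // ltW.
  have t7 : 0 <= delta * H by rewrite mulr_ge0 // ltW.
  have t8 : 0 <= b2 * frob q q by rewrite mulr_ge0.
  have t9 : 0 <= b2 * frob nu nu by rewrite mulr_ge0.
  have t10 : 0 <= delta * (b2 * frob q q) by rewrite mulr_ge0 // ltW.
  have t11 : 0 <= delta * (b2 * frob nu nu) by rewrite mulr_ge0 // ltW.
  rewrite /storage /c2 -/nu; lra.
suff rate : storage_rate eps delta (h + nu) e mu eta <= - (r * (frob q q + frob nu nu + H)).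
  apply: le_trans rate _; rewrite mulNr lerN2 -mulrA ler_pM2l //.
  by rewrite mulrC ler_pdivrMr // mulrC.
have theta2i : theta2 != 0 by rewrite gt_eqF.
have x1 : frob eta0 h <= omega / 8 * frob q q + k1 * H.
  have gm0 : 0 < omega / (8 * theta2) by rewrite divr_gt0 // mulr_gt0.
  have := frob_young h eta0 gm0; rewrite (frobC h eta0).
  have -> : (4 * (omega / (8 * theta2)))^-1 = theta2 * 2 / omega.
    by field; rewrite theta2i gt_eqF.
  have y1 : omega / (8 * theta2) * frob h h <= omega / 8 * frob q q.
    apply: (@le_trans _ _ (omega / (8 * theta2) * (theta2 * frob q q))).
      by rewrite ler_pM2l.
    by rewrite le_eqVlt; apply/orP; left; apply/eqP; field.
  have y2 : theta2 * 2 / omega * frob eta0 eta0 <= k1 * H.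
    apply: (@le_trans _ _ (theta2 * 2 / omega * (b2 * H))).
      by rewrite ler_pM2l // divr_gt0 // mulr_gt0.
    by rewrite le_eqVlt; apply/orP; left; apply/eqP; rewrite /k1; ring.
  lra.
have x2 : - frob h nu <= theta2 * frob q q + 4^-1 * frob nu nu.
  have := frob_young (- h) nu ltr01; rewrite mulr1 mul1r !frobNl frobNr opprK; lra.
have x3 : 2 * frob h g <= omega / 8 * frob q q + k2 * H.
  have gm0 : 0 < omega / (16 * theta2) by rewrite divr_gt0 // mulr_gt0.
  have := frob_young h g gm0.
  have -> : (4 * (omega / (16 * theta2)))^-1 = 4 * theta2 / omega.
    by field; rewrite theta2i gt_eqF.
  have y1 : omega / (16 * theta2) * frob h h <= omega / 16 * frob q q.
    apply: (@le_trans _ _ (omega / (16 * theta2) * (theta2 * frob q q))).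
      by rewrite ler_pM2l.
    by rewrite le_eqVlt; apply/orP; left; apply/eqP; field.
  have y2 : 4 * theta2 / omega * frob g g <= 4 * theta2 / omega * (p2 * H).
    by rewrite ler_pM2l // divr_gt0 // mulr_gt0.
  have -> : k2 * H = 2 * (4 * theta2 / omega * (p2 * H)) by rewrite /k2; ring.
  lra.
have x4 : 2 * frob nu g <= delta / 4 * frob nu nu + k3 * H.
  have gm0 : 0 < delta / 8 by rewrite divr_gt0.
  have := frob_young nu g gm0.
  have -> : (4 * (delta / 8))^-1 = 2 / delta by field; rewrite gt_eqF.
  have y2 : 2 / delta * frob g g <= 2 / delta * (p2 * H).
    by rewrite ler_pM2l // divr_gt0.
  have -> : k3 * H = 2 * (2 / delta * (p2 * H)) by rewrite /k3; ring.
  lra.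
have dx2 : delta * - frob h nu <= delta * (theta2 * frob q q + 4^-1 * frob nu nu).
  by rewrite ler_pM2l.
have LE : delta * frob (L *m e) (L *m e) <= delta * (ell * (2 * frob q q + 2 * (b2 * H))).
  rewrite ler_pM2l //; apply: le_trans (leL _) _; exact: ler_wpM2l.
have fastH : eps^-1 * gram_form P (fun k => \sum_j M j k *: eta j) eta <= - (k' * H).
  apply: le_trans (ler_wpM2l (ltW _) (negP eta)) _; first by rewrite invr_gt0.
  rewrite mulrN lerN2 ler_wpM2r // -[k']invrK lef_pV2 ?posrE ?invr_gt0 //.
  exact: ltW.
have dA : delta * (theta2 + 2 * ell) * frob q q <= omega / 4 * frob q q.
  by rewrite ler_wpM2r.
have rA : r * frob q q <= omega / 2 * frob q q by rewrite ler_wpM2r.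
have rV : r * frob nu nu <= delta / 2 * frob nu nu by rewrite ler_wpM2r.
have rH : r * H <= 1 * H by rewrite ler_wpM2r.
have k'H : 0 <= k' * H by rewrite mulr_ge0 // ltW.
have k1H : 0 <= k1 * H by rewrite mulr_ge0 // ltW.
have k2H : 0 <= k2 * H by rewrite mulr_ge0 // ltW.
have k3H : 0 <= k3 * H by rewrite mulr_ge0 // ltW.
have k4H : 0 <= 2 * delta * ell * b2 * H by rewrite mulr_ge0 // ltW.
have k'E : k' * H = k1 * H + k2 * H + k3 * H + 2 * delta * ell * b2 * H + H.
  by rewrite /k'; ring.
(* The primal-dual coupling is skew: this term cancels the contribution of [- L *m mu] to the
   derivative of the energy of [e]. *)
have cancel : frob (L *m e) mu = frob e nu by rewrite frob_mulmxl symL.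
have LLe : frob e (L *m (L *m e)) = frob (L *m e) (L *m e).
  by rewrite [RHS]frob_mulmxl symL.
have he : frob h e = frob q h - frob eta0 h by rewrite frobC eE frobDl frobNl.
rewrite /storage_rate /fast_rhs.
rewrite gram_formDl gram_formZl formb cancel LLe.
rewrite !(frobNl, frobDl) he (frobC nu e).
clear -x1 x3 x4 dx2 LE fastH dA rA rV rH k'E k'H k1H k2H k3H k4H qh H0.
lra.
Qed.
End Estimate.

Lemma gram_form_ode (R : realType) (N m n : nat) (P : 'M[R]_n)
    (X dX : 'I_n -> R -> 'M[R]_(N, m)) :
  (forall k l, P k l = P l k) -> (forall k, mx_ode_on_nneg (X k) (dX k)) ->
  @ode_on_nneg R R^o (fun t => gram_form P (X ^~ t) (X ^~ t))
    (fun t => 2 * gram_form P (dX ^~ t) (X ^~ t)).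
Proof.
move=> symP hX.
apply: (@ode_on_nneg_ext _ (fun t => \sum_k \sum_l P k l * frob (X k t) (X l t)) _
  (fun t => \sum_k \sum_l P k l * (frob (dX k t) (X l t) + frob (X k t) (dX l t)))) => // [t|].
  rewrite mulr_natl mulr2n {2}gram_formC // /gram_form -big_split.
  apply: eq_bigr => k _; rewrite -big_split; apply: eq_bigr => l _ /=.
  by rewrite mulrDr.
by do 2![apply: ode_on_nneg_sum => ? _]; apply: ode_on_nnegZ; apply: ode_frob.
Qed.

(** The costs enter only through [h] and two quadratic inequalities that relate it to [q]. The bound
    on [eps] and the rate precede the trajectory; only [D] depends on it, through the initial
    storage. *)
Lemma slow_fast_decay (R : realType) (N m n : nat) (a : 'M[R]_N) (M : 'M[R]_n)
    (b : 'I_n -> R) (omega theta : R) :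
  weighted_graph a -> connected_graph a -> hurwitz_mx M ->
  0 < omega -> 0 < theta ->
  exists eps_star alpha : R, [/\ 0 < eps_star, 0 < alpha &
  forall (eps : R) (e mu h : R -> 'M[R]_(N, m)) (eta : 'I_n -> R -> 'M[R]_(N, m)),
    0 < eps -> eps < eps_star ->
    mx_ode_on_nneg e (fun t => - (h t + laplacian a *m mu t)) ->
    mx_ode_on_nneg mu (fun t => laplacian a *m e t) ->
    (forall k, mx_ode_on_nneg (eta k) (fun t =>
      eps^-1 *: (\sum_j M j k *: eta j t) + b k *: (h t + laplacian a *m mu t))) ->
    (forall t, 0 <= t -> (const_mx 1 : 'rV[R]_N) *m mu t = 0) ->
    let q t := e t + \sum_k b k *: eta k t in
    (forall t, omega * frob (q t) (q t) <= frob (q t) (h t)) ->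
    (forall t, frob (h t) (h t) <= theta * frob (q t) (q t)) ->
    exists D : R, forall t, 0 <= t ->
      frob (e t) (e t) + frob (mu t) (mu t) + \sum_k frob (eta k t) (eta k t) <=
      D * expR (- alpha * t)].
Proof.
move=> wa ca hM omega0 theta0; set L := laplacian a.
have symL : L^T = L by apply: laplacian_sym.
have [s s0 hs] := laplacian_coercive wa ca m.
have [P [symP [p p0 posP] negP]] := gram_lyapunov N m hM.
have leL (X : 'M[R]_(N, m)) : frob (L *m X) (L *m X) <= frob L L * frob X X.
  exact: frob_mulmx_le.
have [delta [eps_star [rho [c [eps_star0 rho0 c0 est]]]]] :=
  storage_decay b symL omega0 theta0 (frob_ge0 L) s0 p0 leL posP negP.
exists eps_star, rho; split=> // eps e mu h eta eps0 epsS he hmu heta mu0 q hq hh.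
pose W t := storage L P delta (e t) (mu t) (eta ^~ t).
pose dW t := storage_rate L M P b eps delta (h t + L *m mu t) (e t) (mu t) (eta ^~ t).
have W_ode : @ode_on_nneg R R^o W dW.
  have H1 := ode_on_nnegZ 2^-1 (ode_frob he he).
  have H2 := ode_on_nnegZ 2^-1 (ode_frob hmu hmu).
  have H3 := ode_on_nnegZ delta (ode_frob he (mx_ode_mulmx L hmu)).
  have H4 := gram_form_ode symP heta.
  apply: ode_on_nneg_ext (ode_on_nnegD (ode_on_nnegD (ode_on_nnegD H1 H2) H3) H4) => // t.
  rewrite /dW /storage_rate; congr (_ + _ + _ + _).
    by rewrite (frobC (e t)); move: (frob _ _) => x; field.
  by rewrite (frobC (mu t)); move: (frob _ _) => x; field.
have bnd t : 0 <= t ->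
    c * (frob (e t) (e t) + frob (mu t) (mu t) + \sum_k frob (eta k t) (eta k t)) <= W t /\
    dW t <= - rho * W t.
  by move=> t0; apply: (est _ _ _ _ _ eps0 epsS (hs _ (mu0 t t0)) (hq t) (hh t)).
exists (W 0 / c) => t t0.
have : W t <= W 0 * expR (- rho * t).
  have := @gronwall _ W dW rho 0 rho0 W_ode _ t t0.
  rewrite mul0r add0r subr0; apply=> s' s'0; rewrite addr0.
  by case: (bnd s' (ltW s'0)).
have [le _] := bnd t t0; move=> /(le_trans le).
by rewrite mulrAC ler_pdivlMr // mulrC.
Qed.

(** * The integrator chain and the gradient at the minimizer *)

Section Chain.
Variable R : realType.

(* The transposed companion matrix: row vectors evolve by x' = x M. *)
Definition chain_mx (n : nat) (c : nat -> R) : 'M[R]_n :=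
  \matrix_(j, k) if k.+1 == n then - c j else (j == k.+1 :> nat)%:R.

(** A row eigenvector for [s] satisfies [v_(k+1) = s * v_k], so it is [v_0] times the powers of [s]
    with [v_0] nonzero; the last column then says that [s] is a root of the polynomial. *)
Lemma hurwitz_chain_mx (n : nat) (c : nat -> R) :
  hurwitz_poly (\sum_(k < n) c k *: 'X^k + 'X^n) -> hurwitz_mx (chain_mx n c).
Proof.
case: n => [|n] hp s.
  by move=> /eigenvalueP[v _]; rewrite (thinmx0 v) eqxx.
move=> /eigenvalueP[v vM v0]; apply: hp.
have vk k (kn : (k < n)%N) : v 0 (inord k.+1) = s * v 0 (inord k).
  have /rowP/(_ (inord k)) := vM; rewrite !mxE => <-.
  have kn' : (k < n.+1)%N by rewrite ltnW.
  rewrite (bigD1 (inord k.+1)) //= !mxE inordK // inordK ?ltnS //.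
  rewrite eqSS ltn_eqF // eqxx rmorph1 mulr1 big1 ?addr0 // => j /negPf jk.
  rewrite !mxE inordK // eqSS ltn_eqF //.
  suff -> : (j == k.+1 :> nat) = false by rewrite rmorph0 mulr0.
  by rewrite -jk -val_eqE /= inordK.
have vE k : (k < n.+1)%N -> v 0 (inord k) = s ^+ k * v 0 0.
  elim: k => [|k IH] kn; first by rewrite mul1r; congr (v 0 _); apply: val_inj; rewrite /= inordK.
  by rewrite vk // IH ?exprS ?mulrA // ltnW.
have v00 : v 0 0 != 0.
  apply: contraNneq v0 => v00; apply/eqP/rowP => j.
  by rewrite -[j]inord_val vE // v00 mulr0 mxE.
have last : - (\sum_(j < n.+1) (c j)%:C%C * v 0 j) = s * v 0 (inord n).
  have /rowP/(_ (inord n)) := vM; rewrite !mxE => <-; rewrite -sumrN.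
  apply: eq_bigr => j _; rewrite !mxE inordK // eqxx rmorphN /=.
  by rewrite mulrN mulrC.
rewrite /root rmorphD rmorph_sum /= map_polyXn hornerD hornerXn horner_sum.
apply/eqP/(mulIf v00); rewrite mul0r mulrDl mulr_suml.
rewrite [s ^+ _]exprS -mulrA -vE // -last -sumrN -big_split big1 // => j _ /=.
rewrite map_polyZ /= map_polyXn hornerZ hornerXn -mulrA -vE // inord_val.
by rewrite subrr.
Qed.
End Chain.

Section Gradient.
Variable R : realType.

(** Fermat's rule on the line through [x] in direction [v], applied on the interval from -1 to 1. *)
Lemma derive_minimizer (V : normedModType R) (F : V -> R^o) (x v : V) :
  (forall y, differentiable F y) -> (forall y, F x <= F y) -> 'D_v F x = 0.
Proof.
move=> dF minF; pose g (t : R) : R^o := F (t *: v + x).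
have dg t : derivable g t 1.
  apply/derivable1_diffP.
  have dl : differentiable (( *:%R^~ v : R -> V) + cst x) t.
    by apply: differentiableD; [by have [] := is_diff_scalel t v
                               |exact: differentiable_cst].
  exact: (differentiable_comp dl (dF _)).
have g0 : is_derive (0 : R) (1 : R) g 0.
  apply: (@derive1_at_min R g (-1) 1 0 _ (fun t _ => dg t)).
  - lra.
  - by rewrite in_itv /= ltrN10 ltr01.
  - by move=> t _; rewrite /g scale0r add0r.
have quotE : (fun h : R => h^-1 *: ((F \o shift x) (h *: v) - F x)) =
    (fun h : R => h^-1 *: ((g \o shift 0) (h *: (1 : R^o)) - g 0)).
  by apply/funext => h; rewrite /g /= addr0 scale0r add0r /GRing.scale /= mulr1.
by have [_] := g0; rewrite /derive quotE.
Qed.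

(** The single gradients need not vanish at the minimizer; the vanishing of their sum is the
    solvability condition for the multiplier equilibrium. *)
Lemma grad_sum_minimizer (m N : nat) (f : 'I_N -> 'cV[R]_m -> R) (x : 'cV[R]_m) :
  (forall i y, differentiable (f i : 'cV[R]_m -> R^o) y) ->
  minimizer (fun y => \sum_(i < N) f i y) x ->
  forall j, \sum_(i < N) grad (f i) x j 0 = 0.
Proof.
move=> df minf j; pose F : 'cV[R]_m -> R^o := \sum_(i < N) (f i : 'cV[R]_m -> R^o).
have FE y : F y = \sum_(i < N) f i y by rewrite /F fct_sumE.
have dF y : differentiable F y by apply: differentiable_sum => i; exact: df.
have minF y : F x <= F y by rewrite !FE; exact: minf.
have := derive_minimizer (delta_mx j 0) dF minF.
rewrite /F derive_sum => [H|i]; last exact: (diff_derivable (df i x)).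
by rewrite -[RHS]H; apply: eq_bigr => i _; rewrite mxE.
Qed.
End Gradient.

(** * Bounded functions and exponential convergence *)

Section Bounded.
Variable R : realType.
Implicit Types g h : R -> R.

Definition rbounded g := exists B : R, forall t, 0 <= t -> `|g t| <= B.

Lemma rbounded_cst (c : R) : rbounded (fun=> c).
Proof. by exists `|c|. Qed.

Lemma rboundedD g h : rbounded g -> rbounded h -> rbounded (fun t => g t + h t).
Proof.
move=> [B hB] [C hC]; exists (B + C) => t t0.
by apply: le_trans (ler_normD _ _) _; apply: lerD; [apply: hB|apply: hC].
Qed.

Lemma rboundedM g h : rbounded g -> rbounded h -> rbounded (fun t => g t * h t).
Proof.
move=> [B hB] [C hC]; exists (B * C) => t t0.
by rewrite normrM ler_pM //; [apply: hB|apply: hC].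
Qed.

Lemma rboundedZ c g : rbounded g -> rbounded (fun t => c * g t).
Proof. by apply: rboundedM; exact: rbounded_cst. Qed.

Lemma rbounded_sum (I : finType) (g : I -> R -> R) :
  (forall i, rbounded (g i)) -> rbounded (fun t => \sum_i g i t).
Proof.
move=> hg; have /choice[B hB] i := hg i.
exists (\sum_i B i) => t t0; apply: le_trans (ler_norm_sum _ _ _) _.
by apply: ler_sum => i _; apply: hB.
Qed.

Lemma rbounded_sqr_le (B : R) g :
  (forall t, 0 <= t -> g t ^+ 2 <= B) -> rbounded g.
Proof.
move=> hg; exists (Num.sqrt B) => t t0.
by rewrite -sqrtr_sqr ler_wsqrtr // hg.
Qed.

Lemma rbounded_eq g h : (forall t, 0 <= t -> g t = h t) -> rbounded g -> rbounded h.
Proof. by move=> gh [B hB]; exists B => t t0; rewrite -gh // hB. Qed.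

Lemma rbounded_mulmx (p q : nat) (A : 'M[R]_(p, q)) (x : R -> 'cV[R]_q) :
  (forall j, rbounded (fun t => x t j 0)) ->
  forall i, rbounded (fun t => (A *m x t) i 0).
Proof.
move=> hx i; apply: (@rbounded_eq (fun t => \sum_j A i j * x t j 0)).
  by move=> t _; rewrite mxE.
by apply: rbounded_sum => j; apply: rboundedZ.
Qed.

Lemma bounded_on_nneg_coords (p : nat) (x : R -> 'cV[R]_p) :
  (forall j, rbounded (fun t => x t j 0)) -> bounded_on_nneg x.
Proof.
move=> hx; have [B hB] : rbounded (fun t => dotp (x t) (x t)).
  by apply: rbounded_sum => j; apply: rboundedM.
exists (Num.sqrt B) => t t0; apply: ler_wsqrtr.
exact: le_trans (ler_norm _) (hB t t0).
Qed.

(** The Lyapunov form of the transpose has derivative at most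
    [- 2 * H + 2 * \sum_l g t l * x t l 0], hence at most [- H + G], where [H] is the squared norm
    of [x] and [G] is bounded; [H] dominates a multiple of the form. *)
Lemma hurwitz_ode_bounded (n : nat) (M : 'M[R]_n) (x d : R -> 'cV[R]_n) :
  hurwitz_mx M ->
  (forall i, @ode_on_nneg R R^o (fun t => x t i 0) (fun t => (M *m x t + d t) i 0)) ->
  (forall i, rbounded (fun t => d t i 0)) ->
  forall i, rbounded (fun t => x t i 0).
Proof.
move=> hM xode dB.
have [P [symP [p p0 posP] negP]] := gram_lyapunov 1 1 (hurwitz_mx_tr hM).
have [p' p'0 leP] := gram_form_le 1 1 P.
pose X k t : 'M[R]_1 := (x t k 0)%:M; pose Dm k t : 'M[R]_1 := (d t k 0)%:M.
pose dX k t : 'M[R]_1 := ((M *m x t + d t) k 0)%:M.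
have Xode k : mx_ode_on_nneg (X k) (dX k).
  by move=> i j; rewrite !ord1 /X /dX; apply: ode_on_nneg_ext (xode k) => t; rewrite [RHS]mxE mulr1n.
have Uode := gram_form_ode symP Xode.
have frob11 (a b : R) : frob (a%:M : 'M[R]_1) (b%:M) = a * b.
  by rewrite /frob !big_ord1 !mxE !mulr1n.
pose g t l := \sum_k P k l * d t k 0.
pose G t := \sum_l g t l ^+ 2.
have [B hB] : rbounded G.
  apply: rbounded_sum => l; have gl : rbounded (g ^~ l).
    by apply: rbounded_sum => k; apply: rboundedZ.
  by apply: rbounded_eq (rboundedM gl gl) => t _; rewrite expr2.
pose H t := \sum_k frob (X k t) (X k t).
have H0 t : 0 <= H t by apply: sumr_ge0 => k _; apply: frob_ge0.
have [C hC] : exists C, forall t, 0 <= t -> gram_form P (X ^~ t) (X ^~ t) <= C.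
  have al0 : 0 < (p' + 1)^-1 by rewrite invr_gt0 ltr_wpDl.
  apply: (gronwall_bounded (be := B) al0 Uode) => t t0.
  have -> : gram_form P (dX ^~ t) (X ^~ t) =
      gram_form P (fun k => \sum_j M^T j k *: X j t) (X ^~ t) +
      gram_form P (Dm ^~ t) (X ^~ t).
    rewrite -gram_formDl; do 2![apply: eq_bigr => ? _]; congr (_ * frob _ _).
    apply/matrixP => i j; rewrite !ord1 !mxE summxE mulr1n; congr (_ + _).
    by apply: eq_bigr => k _; rewrite !mxE mulr1n.
  have n1 := negP (X ^~ t).
  have n2 : gram_form P (Dm ^~ t) (X ^~ t) = \sum_l g t l * x t l 0.
    rewrite /gram_form exchange_big; apply: eq_bigr => l _; rewrite mulr_suml.
    by apply: eq_bigr => k _; rewrite frob11 mulrA.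
  have n3 : 2 * \sum_l g t l * x t l 0 <= G t + H t.
    rewrite mulr_sumr -big_split; apply: ler_sum => l _ /=; rewrite frob11.
    have := sqr_ge0 (g t l - x t l 0); lra.
  have n4 : G t <= B by apply: le_trans (ler_norm _) (hB t (ltW t0)).
  have n5 : (p' + 1)^-1 * gram_form P (X ^~ t) (X ^~ t) <= H t.
    rewrite mulrC ler_pdivrMr ?ltr_wpDl //; apply: le_trans (leP _) _.
    by rewrite mulrC; apply: ler_wpM2l; [exact: H0|rewrite lerDl].
  rewrite n2; rewrite -/(H t) in n1; lra.
move=> i; apply: (@rbounded_sqr_le (C / p)) => t t0.
rewrite ler_pdivlMr // mulrC; apply: le_trans (hC t t0); apply: le_trans (posP _).
rewrite ler_pM2l // expr2 -frob11.
exact: (ler_sum_term (u := fun i => frob (X i t) (X i t)) i (fun=> frob_ge0 _)).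
Qed.

End Bounded.

Section Exponential.
Variable R : realType.

Lemma converges_exponentially_of_sqr (p : nat) (x : R -> 'cV[R]_p) x0 (D al : R) :
  0 < al ->
  (forall t, 0 <= t -> dotp (x t - x0) (x t - x0) <= D * expR (- al * t)) ->
  converges_exponentially x x0.
Proof.
move=> al0 hx; exists (Num.sqrt D), (al / 2); split; first by rewrite divr_gt0.
move=> t t0; rewrite /enorm; apply: le_trans (ler_wsqrtr (hx t t0)) _.
have -> : expR (- al * t) = expR (- (al / 2) * t) ^+ 2.
  by rewrite -expRM_natl; congr expR; field.
rewrite mulrC sqrtrM ?sqr_ge0 // sqrtr_sqr ger0_norm ?expR_ge0 //.
by rewrite mulrC.
Qed.

Lemma converges_exponentially_cvg (p : nat) (x : R -> 'cV[R]_p) x0 :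
  converges_exponentially x x0 ->
  (fun t : R => enorm (x t - x0)) @ +oo --> (0 : R).
Proof.
move=> [M [al [al0 hM]]].
apply: (@squeeze_cvgr _ _ _ _ (fun=> 0) (fun t => M * expR (- al * t))).
- near=> t; rewrite sqrtr_ge0 hM //.
- exact: cvg_cst.
- rewrite -[0](mulr0 M); apply: cvgM; first exact: cvg_cst.
  under eq_fun do rewrite mulNr.
  apply: (cvg_comp (fun t => al * t) (fun t => expR (- t)) _ (@cvgr_expR R)).
  exact: gt0_cvgMry cvg_id.
Unshelve. all: by end_near. Qed.
End Exponential.

(** * A single agent *)

Section Agent.
Variables (R : realType) (kappa m : nat).
Variables (A : 'M[R]_kappa) (B : 'M[R]_(kappa, m)) (C : 'M[R]_(m, kappa)).
Variables (r : 'I_m -> nat).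
Variables (psi : 'M[R]_(kappa - \sum_(i < m) r i, kappa)).
Variables (Pi : 'M[R]_(kappa - \sum_(i < m) r i)).
Variables (Psi : 'M[R]_(kappa - \sum_(i < m) r i, \sum_(i < m) r i)).
Variables (Ups : 'M[R]_(m, kappa - \sum_(i < m) r i)).
Variables (S : 'M[R]_(m, \sum_(i < m) r i)).
Hypotheses (hdeg : vector_relative_degree A B C r).
Hypothesis (hnf : normal_form A B C psi Pi Psi Ups S).
Let n := max_degree r.

Lemma leq_max_degree l : (r l <= n)%N.
Proof. exact: leq_bigmax. Qed.

Lemma ode_linear_coord (p : nat) (D : 'M[R]_(p, kappa)) (x dx : R -> 'cV[R]_kappa) i :
  ode_on_nneg x dx ->
  @ode_on_nneg R R^o (fun t => (D *m x t) i 0) (fun t => (D *m dx t) i 0).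
Proof.
move=> hx.
have H : mx_ode_on_nneg x dx by move=> j k; rewrite !ord1; exact: ode_on_nneg_coord.
exact: (mx_ode_mulmx D H i 0).
Qed.

Variables (x : R -> 'cV[R]_kappa) (w : 'I_m -> nat -> R -> R) (v : R -> 'cV[R]_m).
Let wt t l k := w l k t.
Let u t := \col_(l < m) input_deriv r (wt t) (v t) l 0.
Let ut t := linearizing_input A B C psi Ups S (x t) (u t).
Hypothesis hx : ode_on_nneg x (fun t => A *m x t + B *m ut t).
Hypothesis hw : forall (l : 'I_m) (k : nat), (k < n - r l)%N ->
  ode_on_nneg (w l k : R -> R^o) (fun t => input_deriv r (wt t) (v t) l k.+1).

(** Feedback linearization: the inverse of the decoupling matrix cancels the drift, so the
    derivative of order [r l] of output [l] is [u_l]. *)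
Lemma linearizing_inputE l t :
  (C *m A ^+ (r l).-1 *m (A *m x t + B *m ut t)) l 0 = input_deriv r (wt t) (v t) l 0.
Proof.
have [_ _ decU] := hdeg.
rewrite (hnf (x t) (ut t)).2.
have -> : (C *m A ^+ (r l).-1 *m B *m ut t) l 0 = (decoupling_mx A B C r *m ut t) l 0.
  by rewrite !mxE; apply: eq_bigr => j _; rewrite [in RHS]mxE.
rewrite /ut /linearizing_input mulKVmx //.
rewrite [X in _ + X]mxE [X in _ + (X + _)]mxE [X in _ + (X + _ + _)]mxE.
rewrite [X in _ + (_ + X + _)]mxE [X in _ + (_ + _ + X)]mxE.
ring.
Qed.

(** All channels become integrator chains of the common length [n] with input [v]: below [r l] the
    integrators are those of the plant, where the input is invisible by the relative degree; at
    [r l] the linearizing input takes over; beyond, the integrators are controller states. *)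
Lemma output_deriv_ode (k : nat) l : (k < n)%N ->
  @ode_on_nneg R R^o (fun t => output_deriv A C r (x t) (wt t) k l 0)
    (fun t => if (k.+1 < n)%N then output_deriv A C r (x t) (wt t) k.+1 l 0
              else v t l 0).
Proof.
have [r0 degB _] := hdeg => kn; have rn := leq_max_degree l.
case: (ltngtP k.+1 (r l)) => [kr|rk|kr].
- apply: ode_on_nneg_ext (ode_linear_coord (C *m A ^+ k) l hx) => t.
    by rewrite [RHS]mxE (ltn_trans (ltnSn k) kr).
  rewrite (leq_trans kr rn) [RHS]mxE kr mulmxDr [LHS]mxE (mulmxA _ A) (mulmxA _ B).
  have -> : C *m A ^+ k *m A = C *m A ^+ k.+1 by rewrite exprSr -mulmxA.
  rewrite -[RHS]addr0; congr (_ + _).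
  rewrite [LHS]mxE big1 // => j _; rewrite degB ?mul0r //.
  by rewrite -ltnS prednK.
- rewrite ltnS in rk.
  have kr : (k - r l < n - r l)%N by rewrite ltn_sub2r // (leq_ltn_trans rk).
  apply: ode_on_nneg_ext (hw kr) => t.
    by rewrite [RHS]mxE ltnNge rk.
  rewrite /input_deriv -subSn // ltn_sub2rE; last exact: leqW.
  by case: ifP => // _; rewrite [RHS]mxE ltnNge leqW.
- apply: ode_on_nneg_ext (ode_linear_coord (C *m A ^+ k) l hx) => t.
    by rewrite [RHS]mxE -kr ltnSn.
  have -> : k = (r l).-1 by rewrite -kr.
  rewrite linearizing_inputE /input_deriv subn_gt0 prednK //.
  by case: ifP => // _; rewrite [RHS]mxE ltnn subnn.
Qed.

Hypothesis hpsi : coordinate_completion A B C psi.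
Hypothesis hminphase : hurwitz_mx Pi.

Lemma agent_state_bounded :
  (forall k l, (k < n)%N -> rbounded (fun t => output_deriv A C r (x t) (wt t) k l 0)) ->
  forall j, rbounded (fun t => x t j 0).
Proof.
move=> hY.
have chibB s : rbounded (fun t => (chib_mx A C r *m x t) s 0).
  have kr := ltn_ord (tagnat.sig2 s).
  apply: rbounded_eq (hY (tagnat.sig2 s) (tagnat.sig1 s) _) => [t _|].
    rewrite mxE kr [LHS]mxE [RHS]mxE; apply: eq_bigr => j _.
    by rewrite [in RHS]mxE [in RHS]mxE.
  exact: leq_trans kr (leq_max_degree _).
have chiaB : forall s, rbounded (fun t => (psi *m x t) s 0).
  apply: (hurwitz_ode_bounded (d := fun t => Psi *m (chib_mx A C r *m x t)) hminphase).
    move=> s; apply: ode_on_nneg_ext (ode_linear_coord psi s hx) => // t.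
    by rewrite (hnf (x t) (ut t)).1.
  exact: rbounded_mulmx.
pose T := col_mx psi (chib_mx A C r).
(* Injectivity of the coordinate change yields a left inverse [G], which recovers the plant state
   linearly from its two bounded parts. *)
have /row_fullP[G GT] : row_full T.
  have [_ [g gK _]] := hpsi.
  rewrite /row_full -mxrank_tr; apply: inj_row_free => y yT.
  have : T *m y^T = T *m 0 by rewrite mulmx0 -[T]trmxK -trmx_mul yT trmx0.
  by rewrite !mul_col_mx => /(can_inj gK)/(congr1 trmx); rewrite trmxK trmx0.
move=> j; apply: (@rbounded_eq _ (fun t => (G *m (T *m x t)) j 0)).
  by move=> t _; rewrite mulmxA GT mul1mx.
apply: rbounded_mulmx => s; case: (split_ordP s) => s' ->.
  by apply: rbounded_eq (chiaB s') => t _; rewrite mul_col_mx col_mxEu.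
by apply: rbounded_eq (chibB s') => t _; rewrite mul_col_mx col_mxEd.
Qed.

End Agent.

(** * The closed loop *)

Definition agent_mx (R : realType) (N m : nat) (x : 'I_N -> 'cV[R]_m) : 'M[R]_(N, m) :=
  \matrix_(i, l) x i l 0.

Lemma agent_mxE (R : realType) (N m : nat) (x : 'I_N -> 'cV[R]_m) i l :
  agent_mx x i l = x i l 0.
Proof. by rewrite mxE. Qed.

(* The variable eta_k = eps^k y^(k) - [k = 0] z of all agents. *)
Definition scaled_chain (R : realType) (N kappa m : nat) (A : 'M[R]_kappa)
    (C : 'M[R]_(m, kappa)) (r : 'I_m -> nat) (eps : R)
    (tr : trajectory R N kappa m) (k : nat) (t : R) : 'M[R]_(N, m) :=
  agent_mx (fun i => eps ^+ k *: output_deriv A C r (plant_state tr i t)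
                       (fun l j => input_state tr i l j t) k
                     - (k == 0%N)%:R *: z_state tr i t).

Lemma scaled_chainE (R : realType) (N kappa m : nat) (A : 'M[R]_kappa)
    (C : 'M[R]_(m, kappa)) (r : 'I_m -> nat) (eps : R)
    (tr : trajectory R N kappa m) (k : nat) (t : R) i l :
  scaled_chain A C r eps tr k t i l =
  eps ^+ k * output_deriv A C r (plant_state tr i t)
               (fun l j => input_state tr i l j t) k l 0
  - (k == 0%N)%:R * z_state tr i t l 0.
Proof.
by rewrite /scaled_chain agent_mxE mxE [X in X + _]mxE [X in _ + X]mxE [X in - X]mxE.
Qed.

Lemma output_deriv0 (R : realType) (kappa m : nat) (A : 'M[R]_kappa)
    (C : 'M[R]_(m, kappa)) (r : 'I_m -> nat) x w l : (0 < r l)%N ->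
  output_deriv A C r x w 0 l 0 = (C *m x) l 0.
Proof. by move=> r0; rewrite mxE r0 expr0 [C *m _]mulmx1. Qed.

Lemma frob_agent_mx (R : realType) (N m : nat) (x y : 'I_N -> 'cV[R]_m) :
  frob (agent_mx x) (agent_mx y) = \sum_i dotp (x i) (y i).
Proof. by do 2![apply: eq_bigr => ? _]; rewrite !mxE. Qed.

Lemma agent_mxB (R : realType) (N m : nat) (x y : 'I_N -> 'cV[R]_m) :
  agent_mx x - agent_mx y = agent_mx (fun i => x i - y i).
Proof. by apply/matrixP => i j; rewrite !mxE. Qed.

Lemma enorm_sqr (R : realType) (m : nat) (x : 'cV[R]_m) : enorm x ^+ 2 = dotp x x.
Proof. by rewrite sqr_sqrtr // sumr_ge0 // => i _; rewrite -expr2 sqr_ge0. Qed.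

Section ClosedLoop.
Variables (R : realType) (N kappa m : nat).
Variables (A : 'M[R]_kappa) (B : 'M[R]_(kappa, m)) (C : 'M[R]_(m, kappa)).
Variables (r : 'I_m -> nat).
Variables (psi : 'M[R]_(kappa - \sum_(i < m) r i, kappa)).
Variables (Pi : 'M[R]_(kappa - \sum_(i < m) r i)).
Variables (Psi : 'M[R]_(kappa - \sum_(i < m) r i, \sum_(i < m) r i)).
Variables (Ups : 'M[R]_(m, kappa - \sum_(i < m) r i)).
Variables (S : 'M[R]_(m, \sum_(i < m) r i)).
Variables (a : 'M[R]_N) (omega theta : R).
Variables (f : 'I_N -> 'cV[R]_m -> R) (ystar : 'cV[R]_m) (c : nat -> R).
Hypotheses (hdeg : vector_relative_degree A B C r).
Hypothesis (hnf : normal_form A B C psi Pi Psi Ups S).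
Hypotheses (hgraph : weighted_graph a) (hconn : connected_graph a).
Hypotheses (homega : 0 < omega) (htheta : 0 < theta).
Hypothesis hdiff : forall (i : 'I_N) (y : 'cV[R]_m),
  differentiable (f i : 'cV[R]_m -> R^o) y.
Hypothesis hconv : forall i : 'I_N, strongly_convex omega (f i).
Hypothesis hlip : forall i : 'I_N, lipschitz_grad theta (f i).
Hypothesis hmin : minimizer (fun y : 'cV[R]_m => \sum_(i < N) f i y) ystar.
Hypothesis hc : hurwitz_poly
  (\sum_(k < max_degree r) c k *: 'X^k + 'X^(max_degree r)).
Let n := max_degree r.

(** Multiplying [v] by [eps ^+ n] leaves a combination of the eta_k with coefficients [- c k], the
    reference z being already part of eta_0. The same z contributes [- z'], the gradients plus the
    Laplacian term, to the equation for [k = 0] only. *)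
Lemma scaled_chain_ode (eps : R) (tr : trajectory R N kappa m) (k : 'I_n) :
  0 < eps -> closed_loop A B C psi Ups S a f c eps tr ->
  mx_ode_on_nneg (scaled_chain A C r eps tr k) (fun t =>
    eps^-1 *: (\sum_j chain_mx n c j k *: scaled_chain A C r eps tr j t) +
    (k == 0%N :> nat)%:R *:
      (agent_mx (fun i => grad (f i) (C *m plant_state tr i t)) +
       laplacian a *m agent_mx (fun i => lambda_state tr i t))).
Proof.
move=> eps0 loop i l; have [hx hw hz _] := loop i.
pose w t l k := input_state tr i l k t.
pose v t := virtual_input A C r c eps (plant_state tr i t) (w t) (z_state tr i t).
have hY := output_deriv_ode (v := v) hdeg hnf hx (hw : forall l k, _) l (ltn_ord k).
have Z := ode_on_nneg_coord l hz.
have eps1 : eps != 0 by rewrite gt_eqF.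
apply: ode_on_nneg_ext (ode_on_nnegD (ode_on_nnegZ (eps ^+ k) hY)
  (ode_on_nnegZ (- (k == 0%N :> nat)%:R) Z)) => t.
  by rewrite !mxE mulNr.
rewrite [RHS]mxE; congr (_ + _); last first.
  rewrite [RHS]mxE mulNr -mulrN; congr (_ * _).
  rewrite [RHS]mxE laplacianE [agent_mx _ i l]mxE mxE mxE [X in - (_ + X)]mxE summxE.
  rewrite opprD !opprK.
  by rewrite agent_mxE; congr (_ + _); apply: eq_bigr => j _; rewrite !mxE.
pose Y j := output_deriv A C r (plant_state tr i t) (w t) j l 0.
pose zl := z_state tr i t l 0.
have chainE j : scaled_chain A C r eps tr j t i l = eps ^+ j * Y j - (j == 0%N)%:R * zl.
  exact: scaled_chainE.
rewrite [RHS]mxE summxE.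
under eq_bigr do rewrite mxE chainE mxE.
have [kn|kn] := ltnP k.+1 n.
  rewrite (bigD1 (Ordinal kn)) //= eqxx (ltn_eqF kn) [X in _ + X]big1; last first.
    by move=> j /negPf jk; rewrite -val_eqE /= in jk; rewrite jk mul0r.
  rewrite addr0 !mul1r mul0r subr0 exprS mulrA mulKf //.
have -> : (k.+1 == n) = true by rewrite eqn_leq kn ltn_ord.
have n0 : (0 < n)%N := leq_ltn_trans (leq0n _) (ltn_ord k).
have [r0 _ _] := hdeg.
have Y0 : Y 0%N = (C *m plant_state tr i t) l 0 by exact: output_deriv0.
have En : eps ^+ n = eps * eps ^+ k by rewrite -exprS; congr (_ ^+ _); apply/eqP; rewrite eqn_leq kn ltn_ord.
rewrite -(big_mkord xpredT (fun j => - c j * (eps ^+ j * Y j - (j == 0%N)%:R * zl))).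
rewrite big_ltn // expr0 mul1r eqxx mul1r Y0.
rewrite mxE [X in - (1 / eps ^+ n) * X]mxE [X in - (1 / eps ^+ n) * (X + _)]mxE.
set s1 := (\sum_(1 <= j < max_degree r)
  (eps ^+ j * c j) *: output_deriv A C r (plant_state tr i t) (w t) j) l 0.
have -> : \sum_(1 <= j < n) - c j * (eps ^+ j * Y j - (j == 0%N)%:R * zl) = - s1.
  rewrite /s1 summxE -sumrN; apply: eq_big_nat => j /andP[j0 _].
  by rewrite [in RHS]mxE gtn_eqF // mul0r subr0 -/(Y j); ring.
have -> : (C *m plant_state tr i t - z_state tr i t) l 0 =
    (C *m plant_state tr i t) l 0 - zl by rewrite [LHS]mxE [X in _ + X]mxE.
rewrite En; field; rewrite eps1 expf_neq0 //.
Qed.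

(** The multiplier equilibrium [lstar] comes after the trajectory because it is determined only up
    to a constant row, which the conserved sum of the initial multipliers fixes. *)
Lemma closed_loop_decay : (0 < N)%N -> exists eps_star alpha : R,
  [/\ 0 < eps_star, 0 < alpha &
  forall (eps : R) (tr : trajectory R N kappa m), 0 < eps -> eps < eps_star ->
    closed_loop A B C psi Ups S a f c eps tr ->
    exists (lstar : 'M[R]_(N, m)) (D : R), forall t, 0 <= t ->
      frob (agent_mx (fun i => z_state tr i t - ystar))
           (agent_mx (fun i => z_state tr i t - ystar)) +
      frob (agent_mx (fun i => lambda_state tr i t) - lstar)
           (agent_mx (fun i => lambda_state tr i t) - lstar) +
      \sum_(k < n) frob (scaled_chain A C r eps tr k t) (scaled_chain A C r eps tr k t)
      <= D * expR (- alpha * t)].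
Proof.
move=> N0; pose b (k : 'I_n) : R := (k == 0%N :> nat)%:R.
(* The estimate bounds squared norms, so the Lipschitz constant enters squared. *)
have [es [al [es0 al0 H]]] := slow_fast_decay m b hgraph hconn
  (hurwitz_chain_mx hc) homega (exprn_gt0 2 htheta).
exists es, al; split=> // eps tr eps0 epss loop.
pose ones : 'rV[R]_N := const_mx 1.
pose L := laplacian a.
pose Lm t := agent_mx (fun i => lambda_state tr i t).
pose G t := agent_mx (fun i => grad (f i) (C *m plant_state tr i t)).
pose Gs := agent_mx (fun i => grad (f i) ystar).
have onesE (X : 'M[R]_(N, m)) l : (ones *m X) 0 l = \sum_i X i l.
  by rewrite mxE; apply: eq_bigr => i _; rewrite mxE mul1r.
have onesG : ones *m Gs = 0.
  apply/rowP => l; rewrite onesE [RHS]mxE -[RHS](grad_sum_minimizer hdiff hmin l).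
  by apply: eq_bigr => i _; rewrite agent_mxE.
have [ls onesl Ll] := laplacian_solve hgraph hconn (ones *m Lm 0) N0 onesG.
exists ls.
pose e t := agent_mx (fun i => z_state tr i t - ystar).
pose mu t := Lm t - ls; pose h t := G t - Gs.
(* As [L *m ls = - Gs], passing to deviations from the equilibrium leaves the velocity of z
   unchanged. *)
have hL t : h t + L *m mu t = G t + L *m Lm t.
  by rewrite /mu mulmxBr Ll opprK addrCA [RHS]addrC /h addrNK addrC.
have lam_ode : mx_ode_on_nneg Lm (fun t => L *m e t).
  move=> i l; have [_ _ _ hl] := loop i.
  apply: ode_on_nneg_ext (ode_on_nneg_coord l hl) => t; first by rewrite agent_mxE.
  rewrite laplacianE summxE; apply: eq_bigr => j _; rewrite mxE !agent_mxE !mxE.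
  ring.
have e_ode : mx_ode_on_nneg e (fun t => - (h t + L *m mu t)).
  move=> i l; have [_ _ hz _] := loop i.
  apply: ode_on_nneg_ext (ode_on_nnegD (ode_on_nneg_coord l hz)
    (ode_on_nneg_cst (- ystar l 0))) => t; first by rewrite agent_mxE [RHS]mxE [X in _ = _ + X]mxE.
  rewrite addr0 hL [RHS]mxE [X in _ = - X]mxE laplacianE agent_mxE.
  rewrite [LHS]mxE [X in X + _ = _]mxE [X in _ + X = _]mxE summxE -opprD; congr (- (_ + _)).
  by apply: eq_bigr => j _; rewrite mxE !agent_mxE !mxE.
have mu_ode : mx_ode_on_nneg mu (fun t => L *m e t).
  move=> i l; apply: ode_on_nneg_ext (ode_on_nnegD (lam_ode i l) (ode_on_nneg_cst (- ls i l))) => t.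
    by rewrite [RHS]mxE [X in _ = _ + X]mxE.
  by rewrite addr0.
have eta_ode (k : 'I_n) : mx_ode_on_nneg (scaled_chain A C r eps tr k) (fun t =>
    eps^-1 *: (\sum_j chain_mx n c j k *: scaled_chain A C r eps tr j t) +
    b k *: (h t + L *m mu t)).
  move=> i l; apply: ode_on_nneg_ext (scaled_chain_ode k eps0 loop i l) => // t.
  by rewrite hL.
have mu0 t : 0 <= t -> ones *m mu t = 0.
  move=> t0; rewrite mulmxBr onesl; apply/eqP; rewrite subr_eq0; apply/eqP/rowP => l.
  have O := mx_ode_mulmx ones lam_ode 0 l.
  apply: (ode_on_nneg_constant (x := fun t => (ones *m Lm t) 0 l)) => //.
  apply: ode_on_nneg_ext O => // s.
  by rewrite mulmxA ones_laplacian // mul0mx mxE.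
(* The vector [b] selects eta_0 = y - z, so [q] is the deviation of the outputs, the point where the
   gradients are evaluated. *)
have qE t : e t + \sum_(k < n) b k *: scaled_chain A C r eps tr k t =
    agent_mx (fun i => C *m plant_state tr i t - ystar).
  have [r0 _ _] := hdeg.
  apply/matrixP => i l; have n0 : (0 < n)%N := leq_trans (r0 l) (leq_max_degree r l).
  rewrite mxE summxE (bigD1 (Ordinal n0)) //= [X in _ + (_ + X)]big1 => [|k /negPf k0]; last first.
    by rewrite mxE /b; rewrite -val_eqE /= in k0; rewrite k0 mul0r.
  rewrite addr0 [X in _ + X]mxE scaled_chainE output_deriv0 // /e /b /= !agent_mxE.
  rewrite [X in X + _]mxE [X in _ + X + _]mxE [RHS]mxE [X in _ = _ + X]mxE.
  by rewrite expr0; ring.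
apply: (H eps e mu h _ eps0 epss e_ode mu_ode eta_ode mu0) => t.
- rewrite qE /h /G /Gs agent_mxB !frob_agent_mx mulr_sumr; apply: ler_sum => i _.
  rewrite -enorm_sqr; apply: le_trans (hconv i _ _) _.
  by rewrite /dotp le_eqVlt; apply/orP; left; apply/eqP/eq_bigr => j _; rewrite mulrC.
- rewrite qE /h /G /Gs agent_mxB !frob_agent_mx mulr_sumr; apply: ler_sum => i _.
  rewrite -!enorm_sqr -exprMn ler_sqr ?nnegrE ?sqrtr_ge0 //; first exact: hlip.
  by rewrite mulr_ge0 ?sqrtr_ge0 // ltW.
Qed.
End ClosedLoop.

Lemma frob_row_le (R : realType) (p q : nat) (X : 'M[R]_(p, q)) i :
  \sum_l X i l ^+ 2 <= frob X X.
Proof.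
under eq_bigr do rewrite expr2.
apply: (ler_sum_term (u := fun i => \sum_l X i l * X i l)) => j.
by apply: sumr_ge0 => l _; rewrite -expr2 sqr_ge0.
Qed.

Lemma frob_entry_le (R : realType) (p q : nat) (X : 'M[R]_(p, q)) i l :
  X i l ^+ 2 <= frob X X.
Proof.
apply: le_trans (frob_row_le X i).
by apply: (ler_sum_term (u := fun l => X i l ^+ 2)) => j; exact: sqr_ge0.
Qed.

Theorem theorem5 (R : realType) (N kappa m : nat)
    (A : 'M[R]_kappa) (B : 'M[R]_(kappa, m)) (C : 'M[R]_(m, kappa))
    (r : 'I_m -> nat)
    (psi : 'M[R]_(kappa - \sum_(i < m) r i, kappa))
    (Pi : 'M[R]_(kappa - \sum_(i < m) r i))
    (Psi : 'M[R]_(kappa - \sum_(i < m) r i, \sum_(i < m) r i))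
    (Ups : 'M[R]_(m, kappa - \sum_(i < m) r i))
    (S : 'M[R]_(m, \sum_(i < m) r i))
    (a : 'M[R]_N)
    (omega theta : R) (f : 'I_N -> 'cV[R]_m -> R) (ystar : 'cV[R]_m)
    (c : nat -> R)
    (hdeg : vector_relative_degree A B C r)
    (hpsi : coordinate_completion A B C psi)
    (hnf : normal_form A B C psi Pi Psi Ups S)
    (hminphase : hurwitz_mx Pi)
    (hgraph : weighted_graph a)
    (hconn : connected_graph a)
    (homega : 0 < omega) (htheta : 0 < theta)
    (hdiff : forall (i : 'I_N) (y : 'cV[R]_m),
        differentiable (f i : 'cV[R]_m -> R^o) y)
    (hconv : forall i : 'I_N, strongly_convex omega (f i))
    (hlip : forall i : 'I_N, lipschitz_grad theta (f i))
    (hmin : minimizer (fun y : 'cV[R]_m => \sum_(i < N) f i y) ystar)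
    (hc : hurwitz_poly
        (\sum_(k < max_degree r) c k *: 'X^k + 'X^(max_degree r))) :
  exists eps_star : R, 0 < eps_star /\
    forall eps : R, 0 < eps -> eps < eps_star ->
      let loop := closed_loop A B C psi Ups S a f c eps in
      solves_optimal_output_consensus C r ystar loop /\
      forall tr : trajectory R N kappa m, loop tr ->
        forall i : 'I_N, converges_exponentially (output C tr i) ystar.
Proof.
case: (posnP N) => [N0|N0].
  have noI (i : 'I_N) : False by case: i => k; rewrite N0.
  exists 1; split; first exact: ltr01.
  move=> eps _ _ loop; split; first by move=> tr _; split=> i; case: (noI i).
  by move=> tr _ i; case: (noI i).
have [es [al [es0 al0 H]]] := closed_loop_decay hdeg hnf hgraph hconn homega htheta
  hdiff hconv hlip hmin hc N0.
exists es; split=> // eps eps0 epss /=; set n := max_degree r.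
suff key (tr : trajectory R N kappa m) : closed_loop A B C psi Ups S a f c eps tr ->
    bounded_trajectory r tr /\ forall i, converges_exponentially (output C tr i) ystar.
  split=> tr loop; have [bt ce] := key tr loop => //.
  by split=> // i; exact: converges_exponentially_cvg.
move=> loop; have [ls [D HD]] := H eps tr eps0 epss loop.
have [r0 _ _] := hdeg.
pose e t := agent_mx (fun i => z_state tr i t - ystar).
pose mu t := agent_mx (fun i => lambda_state tr i t) - ls.
pose chain (k : nat) t := scaled_chain A C r eps tr k t.
have e_le t : 0 <= t -> frob (e t) (e t) <= D * expR (- al * t).
  move=> t0; apply: le_trans (HD t t0); rewrite -addrA lerDl addr_ge0 ?frob_ge0 //.
  by apply: sumr_ge0 => k _; exact: frob_ge0.
have mu_le t : 0 <= t -> frob (mu t) (mu t) <= D * expR (- al * t).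
  move=> t0; apply: le_trans (HD t t0); rewrite addrAC lerDr addr_ge0 ?frob_ge0 //.
  by apply: sumr_ge0 => k _; exact: frob_ge0.
have chain_le k t : (k < n)%N -> 0 <= t ->
    frob (chain k t) (chain k t) <= D * expR (- al * t).
  move=> kn t0; apply: le_trans (HD t t0).
  apply: (@le_trans _ _ (\sum_(k < n) frob (chain k t) (chain k t))).
    exact: (ler_sum_term (u := fun k : 'I_n => frob (chain k t) (chain k t))
             (Ordinal kn) (fun=> frob_ge0 _)).
  by rewrite lerDr addr_ge0 ?frob_ge0.
have entry_bounded (X : R -> 'M[R]_(N, m)) i l :
    (forall t, 0 <= t -> frob (X t) (X t) <= D * expR (- al * t)) ->
    rbounded (fun t => X t i l).
  move=> hX; apply: (@rbounded_sqr_le _ `|D|) => t t0.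
  apply: le_trans (frob_entry_le _ _ _) _; apply: le_trans (hX t t0) _.
  apply: le_trans (ler_wpM2r (expR_ge0 _) (ler_norm D)) _.
  by apply: ler_piMr => //; rewrite -expR0 ler_expR mulNr oppr_le0 mulr_ge0 // ltW.
have zB i l : rbounded (fun t => z_state tr i t l 0).
  apply: rbounded_eq (rboundedD (entry_bounded _ i l e_le) (rbounded_cst (ystar l 0))).
  by move=> t _; rewrite agent_mxE [X in X + _]mxE [X in _ + X + _]mxE subrK.
have lamB i l : rbounded (fun t => lambda_state tr i t l 0).
  apply: rbounded_eq (rboundedD (entry_bounded _ i l mu_le) (rbounded_cst (ls i l))).
  by move=> t _; rewrite [X in X + _]mxE [X in _ + X + _]mxE agent_mxE subrK.
have YB i k l : (k < n)%N -> rbounded (fun t => output_deriv A C r (plant_state tr i t)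
    (fun l j => input_state tr i l j t) k l 0).
  move=> kn; have chB := entry_bounded _ i l (fun t => @chain_le k t kn).
  apply: rbounded_eq (rboundedZ ((eps ^+ k)^-1)
    (rboundedD chB (rboundedZ (k == 0%N)%:R (zB i l)))) => t _.
  by rewrite /chain scaled_chainE subrK mulKf // expf_neq0 // gt_eqF.
split=> i.
  have [hx _ _ _] := loop i; split.
  - apply: bounded_on_nneg_coords.
    exact: (agent_state_bounded hnf hx hpsi hminphase (YB i)).
  (* The controller state of index [k] in channel [l] is the entry [k + r l] of the chain of output
     derivatives. *)
  - move=> l k kn; have kn' : (k + r l < n)%N by rewrite addnC -ltn_subRL.
    have [M hM] := YB i _ l kn'; exists M => t t0; have := hM t t0.
    by rewrite mxE ltnNge leq_addl /= addnK.
  - by apply: bounded_on_nneg_coords => l; exact: zB.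
  - by apply: bounded_on_nneg_coords => l; exact: lamB.
(* The output error is the sum of the rows of [e] and eta_0, each with squared norm at most
   [D * expR (- al * t)]; the square of a sum is at most twice the sum of the squares, hence the
   factor 4. *)
apply: (@converges_exponentially_of_sqr _ _ _ _ (4 * D) al) => // t t0.
have e_row := le_trans (frob_row_le (e t) i) (e_le t t0).
have chain_row : \sum_l chain 0%N t i l ^+ 2 <= D * expR (- al * t).
  (* The relative degrees are positive, so [n = 0] occurs only without channels, and the sum is then
     empty. *)
  have [n0|n0] := posnP n.
    rewrite big1 => [|l _]; first exact: le_trans (frob_ge0 _) (e_le t t0).
    by have := leq_trans (r0 l) (leq_max_degree r l); rewrite -/n n0.
  exact: le_trans (frob_row_le _ i) (chain_le 0%N t n0 t0).
apply: (@le_trans _ _ (2 * \sum_l e t i l ^+ 2 + 2 * \sum_l chain 0%N t i l ^+ 2)); last lra.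
rewrite !mulr_sumr -big_split; apply: ler_sum => l _ /=.
have -> : (output C tr i t - ystar) l 0 = e t i l + chain 0%N t i l.
  rewrite /chain scaled_chainE output_deriv0 // agent_mxE [LHS]mxE [X in _ + X = _]mxE.
  by rewrite [X in _ = X + _]mxE [X in _ = _ + X + _]mxE /output /= expr0; ring.
have := sqr_ge0 (e t i l - chain 0%N t i l); move: (e t i l) (chain 0%N t i l) => x y; lra.
Qed.
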